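(* Fix an integer $r\ge 2$. Let $\tau_1,\ldots,\tau_r$ be independent, uniformly random elements of $\mathfrak{M}_n$, and let $p_{\min}=P(\inf(\tau_1,\ldots,\tau_r)=\tau_{\min})$. Then, as $n\to\infty$, \[ p_{\min}=\frac{rA(n)^{r-1}+2r(r-1)A(n-1)A(n)^{r-2}+\Theta\big(A(n-2)A(n)^{r-2}\big)}{A(n)^r}. \]
   Context: A monotone triangle of size $n$ is a triangular array of integers $\tau=(\tau(i,j))_{1\le j\le i\le n}$, with $i$ entries in row $i$, all entries taken from $[n]=\{1,\ldots,n\}$, such that $\tau(i,j)<\tau(i,j+1)$ and $\tau(i,j)\le \tau(i-1,j)\le \tau(i,j+1)$ whenever $1\le j<i$. Let $\mathfrak{M}_n$ be the set of monotone triangles of size $n$ and $A(n)=|\mathfrak{M}_n|$. For $\tau_1,\ldots,\tau_r\in\mathfrak{M}_n$, $\inf(\tau_1,\ldots,\tau_r)$ is the triangle whose $(i,j)$ entry is $\min_k\tau_k(i,j)$. $\tau_{\min}$ is the monotone triangle whose row $i$ is $1,2,\ldots,i$ for every $i\in[n]$. The implied constants in $\Theta$ may depend on $r$. *)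

(* Defs.v *)
From HB Require Import structures.
From mathcomp Require Import all_boot all_order all_algebra.

Set Implicit Arguments.
Unset Strict Implicit.
Unset Printing Implicit Defensive.

Import Order.TTheory GRing.Theory Num.Theory.

Local Open Scope nat_scope.

(* Positions (i, j) with 1 <= j <= i <= n; indices are 1-based. *)
Definition cell (n : nat) : finType :=
  {p : 'I_n.+1 * 'I_n.+1 | 0 < p.2 <= p.1}.

Definition row_of n (c : cell n) : 'I_n.+1 := (val c).1.
Definition col_of n (c : cell n) : 'I_n.+1 := (val c).2.

Definition tri_array (n : nat) : finType := {ffun cell n -> 'I_n.+1}.

(* In the last two clauses a, b and c stand for the positions (i, j),
   (i, j + 1) and (i - 1, j); the existence of the cells a and b already
   forces 1 <= j < i. *)
Definition is_monotone_triangle n (t : tri_array n) : bool :=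
  [&& [forall c : cell n, 0 < t c],
      [forall a : cell n, forall b : cell n,
         (row_of b == row_of a) && (col_of b == (col_of a).+1 :> nat)
         ==> (t a < t b)]
    & [forall a : cell n, forall b : cell n, forall c : cell n,
         [&& row_of b == row_of a, col_of b == (col_of a).+1 :> nat,
             (row_of c).+1 == row_of a :> nat & col_of c == col_of a]
         ==> (t a <= t c <= t b)]].

Definition monotone_triangle (n : nat) : finType :=
  {t : tri_array n | is_monotone_triangle t}.

Definition A (n : nat) : nat := #|monotone_triangle n|.

(* ord_max is the top element of 'I_n.+1, so for r > 0 it does not affect the
   minimum. *)
Definition inf_triangle n r (w : {ffun 'I_r -> monotone_triangle n}) :
    tri_array n :=
  [ffun c => \big[Order.min/ord_max]_(k < r) val (w k) c].

Definition tau_min_array (n : nat) : tri_array n := [ffun c => col_of c].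

Lemma tau_min_subproof n : is_monotone_triangle (tau_min_array n).
Proof.
apply/and3P; split.
- by apply/forallP => c; rewrite ffunE; case/andP: (valP c).
- apply/forallP => a; apply/forallP => b; apply/implyP => /andP[_ /eqP ab].
  by rewrite !ffunE ab.
- apply/forallP => a; apply/forallP => b; apply/forallP => c; apply/implyP.
  by case/and4P => _ /eqP ab _ /eqP ca; rewrite !ffunE ab ca leqnn leqnSn.
Qed.

Definition tau_min (n : nat) : monotone_triangle n :=
  Sub (tau_min_array n) (tau_min_subproof n).

Local Open Scope ring_scope.

Definition uniform_pmf (R : realFieldType) (T : finType) (x : T) : R :=
  #|T|%:R^-1.

(* Probability of E for r independent samples from mu: the joint mass function
   is the product of the marginals. *)
Definition iid_prob (R : realFieldType) (T : finType) (r : nat) (mu : T -> R)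
    (E : pred {ffun 'I_r -> T}) : R :=
  \sum_(w : {ffun 'I_r -> T} | E w) \prod_(k < r) mu (w k).

Definition p_min (R : realFieldType) (r n : nat) : R :=
  iid_prob (@uniform_pmf R (monotone_triangle n))
    (fun w : {ffun 'I_r -> monotone_triangle n} =>
       inf_triangle w == val (tau_min n)).

Definition is_Theta (R : realFieldType) (f g : nat -> R) : Prop :=
  exists c C : R, [/\ 0 < c, 0 < C &
    exists N : nat, forall n : nat, (N <= n)%N -> c * g n <= f n <= C * g n].

(* Main.v *)
Require Import Defs.
From mathcomp Require Import all_boot all_order all_algebra.
From mathcomp Require Import zify.

(**
Let [D t] be the set of rows [i] of a monotone triangle [t] that equal
[1, ..., i]. The infimum of [t_1, ..., t_r] is minimal iff the sets [D t_k]
cover all rows, and the triangles with [i] in [D t] are the pairs of triangles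
of sizes [i] and [n - i].

Monotone triangles form a distributive lattice in which the events
[U \subset D t] are decreasing, so by the Ahlswede-Daykin inequality they are
positively correlated. This makes [A] log-convex, and it bounds the number of
[m]-tuples whose sets [D] cover [U] by
[m ^ #|U| * #{t | U \subset D t} * A n ^ (m - 1)]. Together with a lower bound
[A n >= 2 ^ (c n ^ 2)], log-convexity gives exponential growth of the ratios
[A (n + 1) / A n].

For the upper bound, some [t_k] in a good tuple has [D t_k] large; one sums
over the complement [U] of [D t_k]. The cases [U = set0], [{1}] and [{n - 1}]
give the two main terms, the sets inside [{1, 2, n - 2, n - 1}] contribute
[O(A (n - 2))], and by the growth of [A] all the others together
contribute no more. For the lower bound one keeps the tuples with an entry for
which [U] is [set0], [{1}], [{n - 1}], [{1, n - 1}] or [{2}].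
*)

Set Implicit Arguments.
Unset Strict Implicit.
Unset Printing Implicit Defensive.

Import Order.TTheory GRing.Theory Num.Theory.

Local Open Scope nat_scope.

(** * The Ahlswede-Daykin inequality *)

(** With [x = a0 * b1], [y = a1 * b0], [P = c0 * d1] and [Q = c1 * d0], one has [x, y <= P] and
    [x * y <= P * Q], so [(P - x) * (P - y) >= 0] yields [x + y <= P + Q]. This is the inductive
    step over one coordinate of the cube. *)
Lemma four_numbers (a0 a1 b0 b1 c0 c1 d0 d1 : nat) :
  a0 * b0 <= c0 * d0 -> a0 * b1 <= c0 * d1 -> a1 * b0 <= c0 * d1 ->
  a1 * b1 <= c1 * d1 ->
  (a0 + a1) * (b0 + b1) <= (c0 + c1) * (d0 + d1).
Proof.
move=> h00 h01 h10 h11.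
suff: a0 * b1 + a1 * b0 <= c0 * d1 + c1 * d0 by lia.
have hxy : (a0 * b1) * (a1 * b0) <= (c0 * d1) * (c1 * d0).
  have -> : (a0 * b1) * (a1 * b0) = (a0 * b0) * (a1 * b1) by lia.
  have -> : (c0 * d1) * (c1 * d0) = (c0 * d0) * (c1 * d1) by lia.
  exact: leq_mul.
move: h01 h10 hxy; move: (a0 * b1) (a1 * b0) (c0 * d1) (c1 * d0) => x y P Q.
move=> hx hy hxy; have [P0|P0] := posnP P; first by lia.
have : 0 <= (P - x) * (P - y) by [].
rewrite -(leq_pmul2l P0); nia.
Qed.

(** Nested pairs let an induction on the dimension peel off one Boolean coordinate. *)
Fixpoint cube (n : nat) : finType :=
  if n is n'.+1 then (bool * cube n')%type else unit.

Fixpoint cube_meet n : cube n -> cube n -> cube n :=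
  if n is n'.+1 then fun x y => (x.1 && y.1, cube_meet x.2 y.2)
  else fun _ _ => tt.

Fixpoint cube_join n : cube n -> cube n -> cube n :=
  if n is n'.+1 then fun x y => (x.1 || y.1, cube_join x.2 y.2)
  else fun _ _ => tt.

Fixpoint cube_of n (f : nat -> bool) : cube n :=
  if n is n'.+1 then (f 0, cube_of n' (f \o S)) else tt.

Lemma cube_of_meet n f g :
  cube_meet (cube_of n f) (cube_of n g) = cube_of n (fun k => f k && g k).
Proof. by elim: n f g => //= n IHn f g; rewrite IHn. Qed.

Lemma cube_of_join n f g :
  cube_join (cube_of n f) (cube_of n g) = cube_of n (fun k => f k || g k).
Proof. by elim: n f g => //= n IHn f g; rewrite IHn. Qed.

Lemma cube_of_inj n f g :
  cube_of n f = cube_of n g -> forall k, k < n -> f k = g k.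
Proof.
by elim: n f g => //= n IHn f g [e0 /IHn e] [|k] //; rewrite ltnS; apply: e.
Qed.

Lemma sum_cubeS n (F : cube n.+1 -> nat) :
  \sum_x F x = \sum_(y : cube n) (F (false, y) + F (true, y)).
Proof.
rewrite big_split /=.
rewrite (eq_bigr (fun p => F (p.1, p.2))); last by case.
rewrite -(pair_bigA _ (fun (b : bool) (y : cube n) => F (b, y))) /=.
by rewrite big_bool addnC.
Qed.

Theorem ahlswede_daykin n (a b c d : cube n -> nat) :
  (forall x y, a x * b y <= c (cube_meet x y) * d (cube_join x y)) ->
  (\sum_x a x) * (\sum_x b x) <= (\sum_x c x) * (\sum_x d x).
Proof.
elim: n a b c d => [|n IHn] a b c d h.
  have e (F : cube 0 -> nat) : \sum_x F x = F tt.
    by rewrite (big_pred1 tt) //; case.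
  by rewrite !e; apply: h.
rewrite !sum_cubeS; apply: IHn => x y.
by apply: four_numbers;
  [apply: (h (false, x) (false, y)) | apply: (h (false, x) (true, y))
  |apply: (h (true, x) (false, y)) | apply: (h (true, x) (true, y))].
Qed.

(** The map [code] embeds [T] in a Boolean cube and respects meets and joins; the four functions
    inequality is applied to the indicators of the images of [X], [Y], [Z] and [W]. *)
Lemma daykin (T : finType) (N : nat) (code : T -> nat -> bool)
    (meet join : T -> T -> T) (X Y Z W : {set T}) :
  (forall x y, (forall k, k < N -> code x k = code y k) -> x = y) ->
  (forall x y k, code (meet x y) k = code x k && code y k) ->
  (forall x y k, code (join x y) k = code x k || code y k) ->
  (forall x y, x \in X -> y \in Y -> meet x y \in Z) ->
  (forall x y, x \in X -> y \in Y -> join x y \in W) ->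
  #|X| * #|Y| <= #|Z| * #|W|.
Proof.
move=> code_inj code_meet code_join XYZ XYW.
pose enc x := cube_of N (code x).
have enc_inj : injective enc by move=> x y /cube_of_inj /code_inj.
have enc_ext f g : f =1 g -> cube_of N f = cube_of N g.
  by elim: (N) f g => //= n IHn f g e; rewrite e (IHn _ (g \o S)) // => k /=.
have cardE (S : {set T}) : #|S| = \sum_x (x \in enc @: S).
  by rewrite -(card_imset S enc_inj) -sum1_card big_mkcond.
rewrite !cardE; apply: ahlswede_daykin => u v.
case: imsetP => [[x xX ->]|] //; case: imsetP => [[y yY ->]|] //.
have -> : cube_meet (enc x) (enc y) = enc (meet x y).
  by rewrite cube_of_meet; apply: enc_ext => k; rewrite code_meet.
have -> : cube_join (enc x) (enc y) = enc (join x y).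
  by rewrite cube_of_join; apply: enc_ext => k; rewrite code_join.
by rewrite !imset_f ?XYZ ?XYW.
Qed.

(** * Tuples of sets covering a finite type *)

Lemma card_ffun_pick (M : finType) m (k : 'I_m.+1)
    (P : M -> {ffun 'I_m -> M} -> bool) :
  #|[set w : {ffun 'I_m.+1 -> M} | P (w k) [ffun j => w (lift k j)]]| =
  \sum_t #|[set w | P t w]|.
Proof.
pose ins (p : M * {ffun 'I_m -> M}) : {ffun 'I_m.+1 -> M} :=
  [ffun j => if unlift k j is Some j' then p.2 j' else p.1].
pose out (w : {ffun 'I_m.+1 -> M}) := (w k, [ffun j => w (lift k j)]).
have insK : cancel ins out.
  case=> t w; rewrite /out /ins ffunE unlift_none; congr (_, _).
  by apply/ffunP => j; rewrite !ffunE liftK.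
have outK : cancel out ins.
  move=> w; apply/ffunP => j; rewrite ffunE.
  by case: unliftP => [j' ->|->] //=; rewrite ffunE.
have -> : \sum_t #|[set w | P t w]| = #|[set p | P p.1 p.2]|.
  rewrite -sum1_card (eq_bigl (fun p => P p.1 p.2)); last by move=> p; rewrite inE.
  rewrite -(pair_big_dep predT P (fun _ _ => 1)) /=.
  by apply: eq_bigr => t _; rewrite -sum1_card; apply: eq_bigl => w; rewrite inE.
rewrite -(card_imset _ (can_inj outK)); apply: eq_card => p; rewrite inE.
apply/imsetP/idP => [[w + ->]|Pp]; first by rewrite inE.
exists (ins p); rewrite ?insK // inE.
by rewrite [ins p k](congr1 fst (insK p)) [finfun _](congr1 snd (insK p)).
Qed.

(** Binomial expansion of [(1 + m) ^ #|U|], with the subsets grouped by size. *)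
Lemma sum_subset_expn (I : finType) (U : {set I}) m :
  \sum_(T : {set I} | T \subset U) m ^ #|T| = m.+1 ^ #|U|.
Proof.
rewrite -add1n expnDn.
rewrite (partition_big (fun T : {set I} => inord #|T| : 'I_(#|U|.+1)) predT) //=.
apply: eq_bigr => i _; rewrite exp1n mul1n.
have cardT (T : {set I}) : T \subset U -> (inord #|T| == i) = (#|T| == i :> nat).
  by move=> TU; rewrite -val_eqE /= inordK // ltnS subset_leq_card.
rewrite (eq_bigr (fun _ => m ^ i)) => [|T /andP[TU]]; last by rewrite cardT // => /eqP ->.
rewrite sum_nat_const -(cards_draws U i) cardsE; congr (_ * _).
by apply: eq_card => T; rewrite unfold_in /=; apply: andb_id2l => TU; rewrite cardT.
Qed.

Section Cover.
Variables (M I : finType) (D : M -> {set I}).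
Let a := #|M|.

Definition superset_count (U : {set I}) : nat := #|[set t | U \subset D t]|.

Definition covers m (w : {ffun 'I_m -> M}) (U : {set I}) : bool :=
  [forall i in U, exists k, i \in D (w k)].

Definition cov m (U : {set I}) : nat :=
  #|[set w : {ffun 'I_m -> M} | covers w U]|.

Lemma coversP m (w : {ffun 'I_m -> M}) (U : {set I}) :
  reflect (forall i, i \in U -> exists k, i \in D (w k)) (covers w U).
Proof.
apply: (iffP forall_inP) => h i iU; first by have /existsP := h i iU.
by apply/existsP; apply: h.
Qed.

Lemma covers_lift m (k : 'I_m.+1) (w : {ffun 'I_m.+1 -> M}) U :
  covers w U = covers [ffun j => w (lift k j)] (U :\: D (w k)).
Proof.
apply/coversP/coversP => h i.
  rewrite inE => /andP[iNk iU]; have [j ij] := h i iU.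
  case: (unliftP k j) => [j' jE|jk]; last by rewrite -jk ij in iNk.
  by exists j'; rewrite ffunE -jE.
move=> iU; case ik: (i \in D (w k)); first by exists k.
have [|j] := h i; first by rewrite inE ik.
by rewrite ffunE => ij; exists (lift k j).
Qed.

Lemma cov_pick m (k : 'I_m.+1) (Q : pred M) U :
  #|[set w : {ffun 'I_m.+1 -> M} | Q (w k) && covers w U]| =
  \sum_(t | Q t) cov m (U :\: D t).
Proof.
rewrite -(eq_card (A := [set w : {ffun 'I_m.+1 -> M} |
   Q (w k) && covers [ffun j => w (lift k j)] (U :\: D (w k))])).
  rewrite (card_ffun_pick k (fun t w => Q t && covers w (U :\: D t))).
  rewrite [RHS]big_mkcond; apply: eq_bigr => t _; case: (Q t) => //.
  by apply: eq_card0 => w; rewrite inE.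
by move=> w; rewrite !inE -covers_lift.
Qed.

Lemma covS m U : cov m.+1 U = \sum_t cov m (U :\: D t).
Proof. by rewrite -(cov_pick ord0 predT). Qed.

Lemma cov_set0 m : cov m set0 = a ^ m.
Proof.
rewrite -[m in RHS]card_ord -card_ffun -cardsT; apply: eq_card => w.
by rewrite !inE; apply/coversP => i; rewrite inE.
Qed.

Lemma superset_count_set0 : superset_count set0 = a.
Proof. by rewrite /a -cardsT; apply: eq_card => t; rewrite !inE sub0set. Qed.

Lemma cov_ge m U : superset_count U * a ^ m <= cov m.+1 U.
Proof.
rewrite covS (bigID (fun t => U \subset D t)) /=.
apply: leq_trans (leq_addr _ _).
rewrite (eq_bigr (fun _ => a ^ m)) => [|t]; last first.
  by rewrite -setD_eq0 => /eqP ->; rewrite cov_set0.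
by rewrite sum_nat_const /superset_count cardsE.
Qed.

(** Pigeonhole: [m] sets that cover [I] have total size at least [#|I|]. *)
Lemma covers_large m (w : {ffun 'I_m -> M}) :
  0 < m -> covers w [set: I] -> exists k, #|I| <= m * #|D (w k)|.
Proof.
move=> m0 /coversP h.
case: (boolP [exists k, #|I| <= m * #|D (w k)|]) => [/existsP //|].
rewrite negb_exists => /forallP small.
have hI : #|I| <= \sum_k #|D (w k)|.
  rewrite (eq_bigr (fun k => \sum_i (i \in D (w k)))); last first.
    by move=> k _; rewrite -sum1_card big_mkcond.
  rewrite exchange_big /= -sum1_card; apply: leq_sum => i _.
  have [k ik] := h i (in_setT i).
  by rewrite (bigD1 k) //= ik.
have : m * \sum_k #|D (w k)| <= \sum_(k < m) #|I|.-1.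
  rewrite big_distrr; apply: leq_sum => k _ /=.
  by have := small k; rewrite -ltnNge => h'; rewrite -ltnS (ltn_predK h').
rewrite sum_nat_const card_ord leq_pmul2l // => /(leq_trans hI).
have := small (Ordinal m0); rewrite -ltnNge => h'.
by rewrite -ltnS (ltn_predK h') ltnn.
Qed.

(** Union bound over the position of a large entry, which exists by [covers_large]; the other
    entries must cover the complement of its set. The restriction to large [D t] later keeps that
    complement away from full size. *)
Lemma cov_upper m (N := cov m.+1 [set: I]) :
  N <= m.+1 * \sum_(t | #|I| <= m.+1 * #|D t|) cov m (~: D t).
Proof.
pose Q t := #|I| <= m.+1 * #|D t|.
have -> : m.+1 * \sum_(t | Q t) cov m (~: D t) =
    \sum_k #|[set w : {ffun 'I_m.+1 -> M} | Q (w k) && covers w [set: I]]|.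
  rewrite [RHS](eq_bigr (fun _ => \sum_(t | Q t) cov m (~: D t))).
    by rewrite sum_nat_const card_ord.
  by move=> k _; rewrite cov_pick; apply: eq_bigr => t _; rewrite setTD.
rewrite (eq_bigr (fun k => \sum_(w | covers w [set: I]) Q (w k))); last first.
  move=> k _; rewrite -sum1_card big_mkcond [RHS]big_mkcond.
  by apply: eq_bigr => w _; rewrite inE andbC; case: (covers _ _); case: (Q _).
rewrite exchange_big /= /N /cov -sum1dep_card.
apply: leq_sum => w /covers_large [] // k Qk.
by rewrite (bigD1 k) //= [Q _]Qk.
Qed.

(* Bonferroni: a tuple with [x] entries in [Z] is counted [x] times, and
   [x <= 1 + x (x - 1)]. *)
Lemma cov_lower m (Z : {set M}) :
  m.+2 * \sum_(t in Z) cov m.+1 (~: D t) <=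
  cov m.+2 [set: I] + m.+2 * m.+1 * #|Z| ^ 2 * a ^ m.
Proof.
have -> : m.+2 * \sum_(t in Z) cov m.+1 (~: D t) =
    \sum_(w : {ffun 'I_m.+2 -> M} | covers w [set: I]) \sum_k (w k \in Z).
  rewrite exchange_big [RHS](eq_bigr (fun _ => \sum_(t in Z) cov m.+1 (~: D t))) /=.
    by rewrite sum_nat_const card_ord.
  move=> k _; under [RHS]eq_bigr => t _ do rewrite -setTD.
  rewrite -(cov_pick k (fun t => t \in Z)) -sum1_card.
  rewrite [LHS]big_mkcond [RHS]big_mkcond.
  by apply: eq_bigr => w _; rewrite inE andbC; case: (covers _ _); case: (_ \in Z).
have pairs (k : 'I_m.+2) (l : 'I_m.+1) :
    \sum_(w : {ffun 'I_m.+2 -> M}) (w k \in Z) * (w (lift k l) \in Z) =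
    #|Z| ^ 2 * a ^ m.
  have one (l' : 'I_m.+1) : #|[set w : {ffun 'I_m.+1 -> M} | w l' \in Z]| = #|Z| * a ^ m.
    rewrite (card_ffun_pick l' (fun t _ => t \in Z)).
    rewrite (bigID (mem Z)) /= addnC big1 => [|t /negbTE ->]; last first.
      by apply: eq_card0 => w; rewrite inE.
    rewrite (eq_bigr (fun _ => a ^ m)) ?sum_nat_const // => t ->.
    rewrite -[m in RHS]card_ord -card_ffun -cardsT.
    by apply: eq_card => w; rewrite !inE.
  transitivity #|[set w : {ffun 'I_m.+2 -> M} |
      (w k \in Z) && ([ffun j => w (lift k j)] l \in Z)]|.
    rewrite -sum1_card [RHS]big_mkcond; apply: eq_bigr => w _.
    by rewrite inE ffunE; case: (_ \in Z) => //; case: (_ \in Z).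
  rewrite (card_ffun_pick k (fun t (w : {ffun 'I_m.+1 -> M}) => (t \in Z) && (w l \in Z))).
  rewrite (bigID (mem Z)) /= addnC big1 => [|t /negbTE ->]; last first.
    by apply: eq_card0 => w; rewrite inE.
  rewrite (eq_bigr (fun _ => #|Z| * a ^ m)) => [|t ->]; last by rewrite -(one l).
  by rewrite sum_nat_const; lia.
have -> : m.+2 * m.+1 * #|Z| ^ 2 * a ^ m =
    \sum_(w : {ffun 'I_m.+2 -> M}) \sum_k \sum_l (w k \in Z) * (w (lift k l) \in Z).
  rewrite exchange_big (eq_bigr (fun _ => m.+1 * (#|Z| ^ 2 * a ^ m))) /=; last first.
    move=> k _; rewrite exchange_big /= (eq_bigr (fun _ => #|Z| ^ 2 * a ^ m)) //.
    by rewrite sum_nat_const card_ord.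
  by rewrite sum_nat_const card_ord; lia.
rewrite /cov -sum1dep_card.
rewrite [X in _ <= _ + X](bigID (fun w => covers w [set: I])) /= addnA.
apply: leq_trans (leq_addr _ _); rewrite -big_split; apply: leq_sum => w _ /=.
case: (boolP [exists k, w k \in Z]) => [/existsP[k kZ]|]; last first.
  rewrite negb_exists => /forallP h; rewrite big1 // => k _.
  by rewrite (negbTE (h k)).
(* The pairs with first position [k] already count every other entry in [Z]. *)
rewrite (bigD1 k) //= kZ leq_add2l [X in _ <= X](bigD1 k) //= kZ.
apply: leq_trans (leq_addr _ _).
rewrite (reindex (lift k)) /=.
  rewrite (eq_bigl predT); last by move=> l; rewrite eq_sym neq_lift.
  by apply: leq_sum => l _; rewrite mul1n.
exists (fun j => odflt ord0 (unlift k j)) => l; rewrite inE => h.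
  by rewrite liftK.
by case: unliftP h => [j ->|->] //=; rewrite eqxx.
Qed.

Hypothesis correlation :
  forall S T, superset_count S * superset_count T <= superset_count (S :|: T) * a.

(** Induction on [m], sorting by the part [T] of [U] that the first entry leaves uncovered. That
    entry contains [U :\: T], the others cover [T], and [correlation] merges the two counts into one
    for [U]. Summing [m ^ #|T|] over [T] gives [m.+1 ^ #|U|]. *)
Lemma cov_le m U : a * cov m U <= m ^ #|U| * superset_count U * a ^ m.
Proof.
elim: m U => [|m IHm] U.
  rewrite expn0 muln1; have [->|/set0Pn[i iU]] := eqVneq U set0.
    by rewrite cov_set0 cards0 superset_count_set0 !expn0 mul1n muln1.
  rewrite /cov (eq_card0 (A := [set _ | _])) ?muln0 // => w; rewrite inE.
  by apply/negbTE/negP => /coversP /(_ i iU) [[]].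
rewrite covS.
rewrite (partition_big (fun t => U :\: D t) (fun T => T \subset U)) /=; last first.
  by move=> t _; apply: subsetDl.
rewrite -sum_subset_expn big_distrr /= -mulnA big_distrl /=.
apply: leq_sum => T TU.
rewrite (eq_bigr (fun _ => cov m T)) => [|t /eqP -> //].
rewrite sum_nat_const mulnCA.
apply: leq_trans (leq_mul (leqnn _) (IHm T)) _.
have h : #|[pred t | U :\: D t == T]| <= superset_count (U :\: T).
  apply: subset_leq_card; apply/subsetP => t; rewrite !inE => /eqP <-.
  by apply/subsetP => i; rewrite !inE; case: (i \in D t); case: (i \in U).
apply: leq_trans (leq_mul h (leqnn _)) _.
have := correlation (U :\: T) T.
have -> : (U :\: T) :|: T = U.
  apply/setP => i; rewrite !inE.
  by case: (boolP (i \in T)) => [/(subsetP TU) ->|_]; rewrite ?orbT ?orbF.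
rewrite expnS => hc.
have -> : superset_count (U :\: T) * (m ^ #|T| * superset_count T * a ^ m) =
   m ^ #|T| * a ^ m * (superset_count (U :\: T) * superset_count T) by lia.
by apply: leq_trans (leq_mul (leqnn _) hc) _; lia.
Qed.

End Cover.

(** * Covering one or two points *)

Section CoverPairs.
Variables (M I : finType) (D : M -> {set I}).
Let a := #|M|.

Lemma sum_superset1 i : \sum_t (i \in D t) = superset_count D [set i].
Proof.
rewrite /superset_count -sum1_card [RHS]big_mkcond; apply: eq_bigr => t _.
by rewrite inE sub1set.
Qed.

Lemma sum_superset2 i j : \sum_t (i \in D t) * (j \in D t) = superset_count D [set i; j].
Proof.
rewrite /superset_count -sum1_card [RHS]big_mkcond; apply: eq_bigr => t _.
by rewrite inE subUset !sub1set mulnb.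
Qed.

Lemma set1D (i : I) (S : {set I}) : [set i] :\: S = if i \in S then set0 else [set i].
Proof.
apply/setP => k; rewrite fun_if !inE; case: ifP => iS; rewrite ?inE.
  by case: eqP => [->|]; rewrite ?iS ?andbF.
by case: eqP => [->|]; rewrite ?iS ?andbF.
Qed.

(** Condition on whether the set of the first entry contains [i]; the subtracted term is moved to
    the left. *)
Lemma cov1S m i :
  cov D m.+1 [set i] + superset_count D [set i] * cov D m [set i] =
  superset_count D [set i] * a ^ m + a * cov D m [set i].
Proof.
rewrite covS -sum_superset1 !big_distrl -big_split /=.
rewrite (eq_bigr (fun t => (i \in D t) * a ^ m + cov D m [set i])).
  by rewrite big_split /= sum_nat_const.
by move=> t _; rewrite set1D; case: ifP => _; rewrite ?cov_set0 ?mul1n ?mul0n ?addn0.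
Qed.

(** The recursion [cov1S] depends on [i] only through [superset_count D [set i]]. *)
Lemma eq_cov1 m i j : superset_count D [set i] = superset_count D [set j] ->
  cov D m [set i] = cov D m [set j].
Proof.
move=> eij; elim: m => [|m IHm].
  rewrite /cov !(eq_card0 (A := [set _ | _])) // => w; rewrite inE;
    apply/negbTE/negP => /coversP h; [case: (h j)|case: (h i)]; rewrite ?inE //; by case.
have := cov1S m i; rewrite eij IHm -(cov1S m j) => /eqP.
by rewrite eqn_add2r => /eqP.
Qed.

Hypothesis correlation :
  forall S T, superset_count D S * superset_count D T <= superset_count D (S :|: T) * a.

(* The loss from tuples covering [i] twice is of the same order as the number
   of tuples covering [i] and [j] by different entries, and the two cancel. *)
Lemma cov_pair_lower m i j B E : i != j ->
  superset_count D [set i] = B -> superset_count D [set j] = B ->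
  superset_count D [set i; j] = E -> (2 * m ^ 2 + 2 * m) * B <= a ->
  2 * m * B * a ^ m <=
  a * (cov D m [set i] + cov D m [set j] + cov D m [set i; j]).
Proof.
move=> ij iB jB ijE; elim: m => [|m IHm] hm; first by rewrite muln0 !mul0n.
have {}IHm : 2 * m * B * a ^ m <=
    a * (cov D m [set i] + cov D m [set j] + cov D m [set i; j]).
  by apply: IHm; apply: leq_trans hm; rewrite -!mulnn; nia.
have cE : cov D m [set j] = cov D m [set i] by apply: eq_cov1; rewrite iB jB.
have hc := cov_le correlation m [set i]; have hd := cov_le correlation m [set i; j].
rewrite cards1 expn1 iB -/a in hc; rewrite cards2 ij ijE -/a in hd.
rewrite cE in IHm.
set c := cov D m [set i] in cE hc IHm.
set d := cov D m [set i; j] in hd IHm.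
set s' := (_ + _ + _).
have pairD (S : {set I}) : [set i; j] :\: S =
    if i \in S then (if j \in S then set0 else [set j])
    else (if j \in S then [set i] else [set i; j]).
  by rewrite setDUl !set1D; case: (i \in S); case: (j \in S); rewrite ?setU0 ?set0U.
(* Compare both sides entry by entry, over the first entry [t] of the tuple. They agree unless [D t]
   contains both [i] and [j], where the right side exceeds by [d]. *)
have rec : a * (c + c + d) + (2 * B + E) * a ^ m <= s' + 2 * B * d + E * (c + c).
  have -> : a * (c + c + d) + (2 * B + E) * a ^ m = \sum_t ((c + c + d) +
      ((i \in D t) + (j \in D t) + (i \in D t) * (j \in D t)) * a ^ m).
    have cst x : \sum_(t : M) x = a * x by rewrite sum_nat_const.
    rewrite big_split /= cst -big_distrl /= !big_split /=.
    by rewrite !sum_superset1 sum_superset2 iB jB ijE; lia.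
  have -> : s' + 2 * B * d + E * (c + c) = \sum_t
      (cov D m ([set i] :\: D t) + cov D m ([set j] :\: D t) + cov D m ([set i; j] :\: D t)
       + ((i \in D t) + (j \in D t)) * d + (i \in D t) * (j \in D t) * (c + c)).
    rewrite !big_split /= -!covS -!big_distrl /= big_split /=.
    by rewrite !sum_superset1 sum_superset2 iB jB ijE /s'; lia.
  apply: leq_sum => t _; rewrite pairD !set1D.
  case: (i \in D t); case: (j \in D t); rewrite ?cov_set0 ?cE -/a -/c -/d; lia.
(* By [cov_le], the terms to be subtracted are at most the gain [E * a ^ m], because [B] is small
   compared with [a]. Each step then adds [2 * B * a ^ m]. *)
have loss : 2 * B * (a * d) + E * (2 * (a * c)) <= E * a ^ m.+1.
  apply: leq_trans (leq_add (leq_mul (leqnn _) hd) (leq_mul (leqnn _) (leq_mul (leqnn _) hc))) _.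
  have h2 : (2 * m ^ 2 + 2 * m) * B <= a by apply: leq_trans hm; rewrite -!mulnn; nia.
  rewrite [a ^ m.+1]expnS.
  have -> : 2 * B * (m ^ 2 * E * a ^ m) + E * (2 * (m * B * a ^ m)) =
    E * (((2 * m ^ 2 + 2 * m) * B) * a ^ m) by lia.
  by apply: leq_mul => //; apply: leq_mul.
have := leq_mul (leqnn a) rec; rewrite !mulnDr.
have -> : a * (2 * B * d) = 2 * B * (a * d) by lia.
move: loss IHm; rewrite [a ^ m.+1]expnS.
move: (a ^ m) => P loss IHm h.
have h3 := leq_mul (leqnn a) IHm.
nia.
Qed.

End CoverPairs.

(** * Monotone triangles *)

(* Entries indexed by plain naturals; positions outside the triangle read 0. *)
Definition entry n (t : tri_array n) (i j : nat) : nat :=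
  if (insub (inord i, inord j) : option (cell n)) is Some c then t c else 0.

(** The conditions are stated for natural indices inside the triangle, so that [lia] can handle
    them; values elsewhere are free. *)
Definition monotone_fun n (F : nat -> nat -> nat) : Prop :=
  (forall i j, 0 < j -> j <= i -> i <= n -> 0 < F i j <= n) /\
  (forall i j, 0 < j -> j < i -> i <= n ->
     [/\ F i j < F i j.+1, F i j <= F i.-1 j & F i.-1 j <= F i j.+1]).

Lemma entry_cell n (t : tri_array n) (c : cell n) :
  entry t (row_of c) (col_of c) = t c.
Proof.
rewrite /entry !inord_val.
have -> : (row_of c, col_of c) = val c by rewrite /row_of /col_of; case: (val c).
by rewrite valK.
Qed.

Lemma cellP n i j : 0 < j -> j <= i -> i <= n ->
  exists c : cell n, row_of c = i :> nat /\ col_of c = j :> nat.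
Proof.
move=> j0 ji ilen.
have h : 0 < (inord i : 'I_n.+1, inord j : 'I_n.+1).2
           <= (inord i : 'I_n.+1, inord j : 'I_n.+1).1.
  by rewrite /= !inordK ?ltnS ?j0 ?ji //; apply: leq_trans ilen.
exists (exist (fun p : 'I_n.+1 * 'I_n.+1 => 0 < p.2 <= p.1) (inord i, inord j) h).
by rewrite /row_of /col_of /= !inordK ?ltnS //; apply: leq_trans ilen.
Qed.

Lemma cell_bounds n (c : cell n) : 0 < col_of c <= row_of c.
Proof. exact: (valP c). Qed.

Lemma row_le n (c : cell n) : row_of c <= n.
Proof. by rewrite -ltnS. Qed.

Lemma monotone_entry n (t : monotone_triangle n) : monotone_fun n (entry (val t)).
Proof.
case: t => t /= /and3P[/forallP tpos /forallP tlt /forallP tint]; split.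
  move=> i j j0 ji ilen; have [c [<- <-]] := cellP j0 ji ilen.
  by rewrite entry_cell tpos -ltnS ltn_ord.
move=> i j j0 ji ilen.
have [a [ai aj]] := cellP j0 (ltnW ji) ilen.
have [b [bi bj]] := cellP (ltn0Sn j) ji ilen.
have hi : j <= i.-1 by lia.
have hi' : i.-1 <= n by lia.
have [c [ci cj]] := cellP j0 hi hi'.
have ea : entry t i j = t a by rewrite -ai -aj entry_cell.
have eb : entry t i j.+1 = t b by rewrite -bi -bj entry_cell.
have ec : entry t i.-1 j = t c by rewrite -ci -cj entry_cell.
rewrite ea eb ec.
have /forallP /(_ b) /implyP h1 := tlt a.
have /forallP /(_ b) /forallP /(_ c) /implyP h2 := tint a.
have rab : row_of b == row_of a by apply/eqP/val_inj; rewrite /= ai bi.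
have cab : col_of b == (col_of a).+1 :> nat by rewrite aj bj.
have rca : (row_of c).+1 == row_of a :> nat by rewrite ci ai prednK //; lia.
have cca : col_of c == col_of a by apply/eqP/val_inj; rewrite /= cj aj.
rewrite rab cab rca cca /= in h1 h2.
by have /andP[? ?] := h2 isT; split=> //; apply: h1.
Qed.

(** The default [tau_min n] is never taken when [monotone_fun n F] holds. *)
Definition triangle_of n (F : nat -> nat -> nat) : monotone_triangle n :=
  insubd (tau_min n) [ffun c => inord (F (row_of c) (col_of c))].

Lemma entry_triangle_of n F i j : monotone_fun n F ->
  0 < j -> j <= i -> i <= n -> entry (val (triangle_of n F)) i j = F i j.
Proof.
move=> [Fb Fm] j0 ji ilen.
have FE (c : cell n) :
    (inord (F (row_of c) (col_of c)) : 'I_n.+1) = F (row_of c) (col_of c) :> nat.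
  have /andP[c0 cr] := cell_bounds c; have /andP[_ h] := Fb _ _ c0 cr (row_le c).
  by rewrite inordK // ltnS.
have tP : is_monotone_triangle
    ([ffun c => inord (F (row_of c) (col_of c))] : tri_array n).
  apply/and3P; split.
  - apply/forallP => c; rewrite ffunE FE.
    by have /andP[c0 cr] := cell_bounds c; have /andP[] := Fb _ _ c0 cr (row_le c).
  - apply/forallP => a; apply/forallP => b; apply/implyP => /andP[/eqP ab /eqP abc].
    rewrite !ffunE !FE ab abc.
    have /andP[a0 _] := cell_bounds a; have /andP[_ br] := cell_bounds b.
    rewrite ab abc in br.
    by have [] := Fm _ _ a0 br (row_le a).
  - apply/forallP => a; apply/forallP => b; apply/forallP => c; apply/implyP.
    case/and4P => /eqP ab /eqP abc /eqP ca /eqP cc.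
    rewrite !ffunE !FE ab abc cc.
    have /andP[a0 _] := cell_bounds a; have /andP[_ br] := cell_bounds b.
    rewrite ab abc in br.
    have [_] := Fm _ _ a0 br (row_le a).
    by rewrite -ca /= => -> ->.
have [c [<- <-]] := cellP j0 ji ilen.
by rewrite entry_cell /triangle_of /insubd insubT /= ffunE FE.
Qed.

Lemma triangle_ext n (s t : monotone_triangle n) :
  (forall i j, 0 < j -> j <= i -> i <= n -> entry (val s) i j = entry (val t) i j) ->
  s = t.
Proof.
move=> e; apply/val_inj/ffunP => c; apply/val_inj => /=.
by have /andP[c0 cr] := cell_bounds c; rewrite -!entry_cell e ?row_le.
Qed.

(** Position (0, 0) is not a cell. The default value makes the dummy row 0 count as a block. *)
Lemma entry00 n (t : tri_array n) : entry t 0 0 = 0.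
Proof.
by rewrite /entry; case: insubP => // c h _; move: h; rewrite /= inordK.
Qed.

Section MonotoneFun.
Variables (n : nat) (F : nat -> nat -> nat).
Hypothesis FP : monotone_fun n F.

Lemma monotone_ge_col i j : 0 < j -> j <= i -> i <= n -> j <= F i j.
Proof.
have [Fb Fm] := FP; move=> j0; elim: j j0 => // -[|j] IHj _ ji ilen.
  by have /andP[] := Fb i 1 isT ji ilen.
have [h _ _] := Fm i j.+1 isT ji ilen.
by have := IHj isT (ltnW ji) ilen; lia.
Qed.

Lemma monotone_col_down i j k : 0 < j -> j <= i -> i + k <= n -> F (i + k) j <= F i j.
Proof.
have [Fb Fm] := FP; move=> j0 ji; elim: k => [|k IHk] h; first by rewrite addn0.
have [_ h1 _] := Fm (i + k.+1) j j0 ltac:(lia) h.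
by apply: leq_trans (IHk ltac:(lia)); rewrite addnS /= in h1 *.
Qed.

Lemma monotone_row i j k : 0 < j -> j + k <= i -> i <= n -> F i j + k <= F i (j + k).
Proof.
have [Fb Fm] := FP; move=> j0 + ilen; elim: k => [|k IHk] h; first by rewrite !addn0.
have [h1 _ _] := Fm i (j + k) ltac:(lia) ltac:(lia) ilen.
by have := IHk ltac:(lia); rewrite !addnS; lia.
Qed.

Lemma monotone_diag i j k : 0 < j -> j <= i -> i + k <= n -> F i j <= F (i + k) (j + k).
Proof.
have [Fb Fm] := FP; move=> j0 ji; elim: k => [|k IHk] h; first by rewrite !addn0.
have [_ _ h1] := Fm (i + k.+1) (j + k) ltac:(lia) ltac:(lia) h.
by apply: leq_trans (IHk ltac:(lia)) _; rewrite !addnS /= in h1 *.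
Qed.

Lemma monotone_row_fixed i j : F i i = i -> 0 < j -> j <= i -> i <= n -> F i j = j.
Proof.
move=> Fi j0 ji ilen.
have := monotone_row (i := i) (k := i - j) j0 ltac:(lia) ilen.
rewrite subnKC // Fi; have := monotone_ge_col j0 ji ilen; lia.
Qed.

(** Columns weakly decrease downwards, and no entry is smaller than its column index. *)
Lemma monotone_fixed_below i a j : F i i = i -> 0 < j -> j <= i -> i <= a -> a <= n ->
  F a j = j.
Proof.
move=> Fi j0 ji ia an.
have := monotone_col_down (k := a - i) j0 ji ltac:(lia).
rewrite subnKC // (monotone_row_fixed Fi) //; last by lia.
have := @monotone_ge_col a j j0 ltac:(lia) an; lia.
Qed.

(** Entries weakly increase along diagonals, down to row [i] whose entries are at most [i]. *)
Lemma monotone_fixed_above i a j : F i i = i -> 0 < j -> j <= a -> a <= i -> i <= n ->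
  F a j <= i.
Proof.
move=> Fi j0 ja ai ilen.
apply: leq_trans (monotone_diag (k := i - a) j0 ja ltac:(lia)) _.
by rewrite (monotone_row_fixed (i := a + (i - a))) ?subnKC //; lia.
Qed.

Lemma monotone_last : 0 < n -> F n n = n.
Proof.
have [Fb _] := FP => n0; have := Fb n n n0 (leqnn n) (leqnn n).
have := monotone_ge_col n0 (leqnn n) (leqnn n); lia.
Qed.

End MonotoneFun.

(* Row [i] is [1, ..., i] exactly when its last entry is [i]. *)
Definition block n (t : monotone_triangle n) (i : nat) : bool :=
  entry (val t) i i == i.

Lemma block0 n (t : monotone_triangle n) : block t 0.
Proof. by rewrite /block entry00. Qed.

Lemma block_size n (t : monotone_triangle n) : block t n.
Proof.
rewrite /block; have [n0|n0] := posnP n.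
  by case: n t n0 => // t _; rewrite entry00.
by rewrite (monotone_last (monotone_entry t)).
Qed.

(** A predicate on [nat], unlike a set of indices, makes sense for all sizes at once, as needed when
    a triangle is split. *)
Definition block_count n (P : pred nat) : nat :=
  #|[set t : monotone_triangle n | [forall i : 'I_n.+1, P i ==> block t i]]|.

(** * The lattice of monotone triangles and positive correlation *)

Definition meet_triangle n (s t : monotone_triangle n) : monotone_triangle n :=
  triangle_of n (fun i j => minn (entry (val s) i j) (entry (val t) i j)).

Definition join_triangle n (s t : monotone_triangle n) : monotone_triangle n :=
  triangle_of n (fun i j => maxn (entry (val s) i j) (entry (val t) i j)).

Lemma meet_triangleP n (s t : monotone_triangle n) i j :
  0 < j -> j <= i -> i <= n -> entry (val (meet_triangle s t)) i j =
    minn (entry (val s) i j) (entry (val t) i j).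
Proof.
apply: (entry_triangle_of (F := fun i j => _)).
have [sb sm] := monotone_entry s; have [tb tm] := monotone_entry t.
split=> {}i {}j j0 ji ilen.
  by move: (sb i j j0 ji ilen) (tb i j j0 ji ilen); lia.
by have [? ? ?] := sm i j j0 ji ilen; have [? ? ?] := tm i j j0 ji ilen; split; lia.
Qed.

Lemma join_triangleP n (s t : monotone_triangle n) i j :
  0 < j -> j <= i -> i <= n -> entry (val (join_triangle s t)) i j =
    maxn (entry (val s) i j) (entry (val t) i j).
Proof.
apply: (entry_triangle_of (F := fun i j => _)).
have [sb sm] := monotone_entry s; have [tb tm] := monotone_entry t.
split=> {}i {}j j0 ji ilen.
  by move: (sb i j j0 ji ilen) (tb i j j0 ji ilen); lia.
by have [? ? ?] := sm i j j0 ji ilen; have [? ? ?] := tm i j j0 ji ilen; split; lia.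
Qed.

Lemma block_meet n (s t : monotone_triangle n) i : i <= n ->
  block s i || block t i -> block (meet_triangle s t) i.
Proof.
move=> ilen; have [->|i0] := posnP i; first by rewrite !block0.
rewrite /block meet_triangleP //.
have := monotone_ge_col (monotone_entry s) i0 (leqnn i) ilen.
have := monotone_ge_col (monotone_entry t) i0 (leqnn i) ilen.
lia.
Qed.

(** The meet inherits the blocks of both triangles. The join is only known to be a triangle, whence
    the factor [A n]. *)
Lemma block_correlation n (P Q : pred nat) :
  block_count n P * block_count n Q <= block_count n (predU P Q) * A n.
Proof.
rewrite /A -cardsT.
(* The Boolean coordinates are the thresholds [v < t c], which turn minima into conjunctions and
   maxima into disjunctions. *)
pose cells : seq (cell n * 'I_n.+1) := enum {: cell n * 'I_n.+1}.
pose code (t : monotone_triangle n) k :=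
  if ohead (drop k cells) is Some (c, v) then v < val t c else false.
apply: (@daykin _ (size cells) code (@meet_triangle n) (@join_triangle n)).
- move=> s t e; apply/val_inj/ffunP => c; apply/val_inj => /=.
  have cE (v : 'I_n.+1) : (v < val s c) = (v < val t c).
    have cv : (c, v) \in cells by rewrite mem_enum.
    have := e (index (c, v) cells); rewrite index_mem => /(_ cv).
    by rewrite /code (drop_nth (c, v)) ?index_mem //= nth_index.
  have := cE (val s c); rewrite ltnn => /esym /negbT; rewrite -leqNgt => h1.
  have := cE (val t c); rewrite ltnn => /negbT; rewrite -leqNgt => h2.
  by apply/eqP; rewrite eqn_leq h1 h2.
- move=> s t k; rewrite /code; case: ohead => [[c v]|] //.
  have /andP[c0 cr] := cell_bounds c.
  by rewrite -!entry_cell meet_triangleP ?row_le // leq_min.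
- move=> s t k; rewrite /code; case: ohead => [[c v]|] //.
  have /andP[c0 cr] := cell_bounds c.
  by rewrite -!entry_cell join_triangleP ?row_le // leq_max.
- move=> s t; rewrite !inE => /forallP sP /forallP tQ; apply/forallP => i.
  apply/implyP => /orP[Pi|Qi]; apply: block_meet; rewrite ?(leq_ord i) //.
    by rewrite (implyP (sP i) Pi).
  by rewrite (implyP (tQ i) Qi) orbT.
- by move=> *; rewrite inE.
Qed.

(** * Gluing two triangles along a block row *)

Definition glue_fun i (F G : nat -> nat -> nat) (a b : nat) : nat :=
  if a <= i then F a b else if b <= i then b else i + G (a - i) (b - i).

Lemma monotone_glue n i F G : i <= n ->
  monotone_fun i F -> monotone_fun (n - i) G -> monotone_fun n (glue_fun i F G).
Proof.
move=> ilen FP GP; have [Fb Fm] := FP; have [Gb Gm] := GP.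
split=> a b b0 ba an; rewrite /glue_fun.
  case: (leqP a i) => ai; first by have := Fb a b b0 ba ai; lia.
  case: (leqP b i) => bi; first by lia.
  by have := Gb (a - i) (b - i) ltac:(lia) ltac:(lia) ltac:(lia); lia.
case: (leqP a i) => ai.
  have -> : a.-1 <= i by lia.
  exact: Fm.
case: (leqP b.+1 i) => bi.
  have -> : b <= i by lia.
  case: (leqP a.-1 i) => ai'; last by split; lia.
  have ? : a.-1 = i by lia.
  have := monotone_ge_col FP b0 (i := a.-1) ltac:(lia) ltac:(lia) => h1.
  have Fi : F i i = i by apply: (monotone_last FP); lia.
  have h2 := monotone_row_fixed FP Fi b0 (ltnW bi) (leqnn i).
  by split; subst; lia.
case: (leqP b i) => bi'.
  have hG := Gb (a - i) (b.+1 - i) ltac:(lia) ltac:(lia) ltac:(lia).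
  case: (leqP a.-1 i) => ai'; last by split; lia.
  have e : a.-1 = i by lia.
  rewrite e; have eb : b = i by lia.
  subst b.
  have Fi : F i i = i by apply: (monotone_last FP); lia.
  by split; lia.
have -> : (a.-1 <= i) = false by lia.
have := Gm (a - i) (b - i) ltac:(lia) ltac:(lia) ltac:(lia).
have -> : (a - i).-1 = a.-1 - i by lia.
have -> : (b - i).+1 = b.+1 - i by lia.
by case=> *; split; lia.
Qed.

Definition glue n i (p : monotone_triangle i * monotone_triangle (n - i)) :
    monotone_triangle n :=
  triangle_of n (glue_fun i (entry (val p.1)) (entry (val p.2))).

Lemma entry_glue n i (p : monotone_triangle i * monotone_triangle (n - i)) a b :
  i <= n -> 0 < b -> b <= a -> a <= n ->
  entry (val (glue p)) a b = glue_fun i (entry (val p.1)) (entry (val p.2)) a b.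
Proof.
move=> ilen; apply: entry_triangle_of.
by apply: monotone_glue => //; apply: monotone_entry.
Qed.

Lemma glue_inj n i : i <= n -> injective (@glue n i).
Proof.
move=> ilen [s t] [s' t'] e; congr (_, _); apply: triangle_ext => a b b0 ba ab.
  have an := leq_trans ab ilen.
  have h := @entry_glue n i (s, t) a b ilen b0 ba an.
  have h' := @entry_glue n i (s', t') a b ilen b0 ba an.
  have := etrans (esym h) (etrans (congr1 (fun u => entry (val u) a b) e) h').
  by rewrite /glue_fun ab.
have [h1 h2 h3] : [/\ 0 < i + b, i + b <= i + a & i + a <= n] by split; lia.
have h := @entry_glue n i (s, t) (i + a) (i + b) ilen h1 h2 h3.
have h' := @entry_glue n i (s', t') (i + a) (i + b) ilen h1 h2 h3.
have := etrans (esym h) (etrans (congr1 (fun u => entry (val u) (i + a) (i + b)) e) h').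
rewrite /glue_fun /=.
have -> : (i + a <= i) = false by lia.
have -> : (i + b <= i) = false by lia.
by rewrite !addKn => /eqP; rewrite eqn_add2l => /eqP ->.
Qed.

Lemma block_glue n i (p : monotone_triangle i * monotone_triangle (n - i)) a :
  i <= n -> a <= i -> block (glue p) a = block p.1 a.
Proof.
move=> ilen ai; have [->|a0] := posnP a; first by rewrite !block0.
by rewrite /block entry_glue ?(leq_trans ai ilen) // /glue_fun ai.
Qed.

(** A block row [i] bounds all entries above it by [i] and forces the first [i] columns below it.
    What remains, shifted by [i] in rows, columns and values, is a triangle of size [n - i]. *)
Lemma glue_onto n i (t : monotone_triangle n) : i <= n -> block t i ->
  exists p, t = @glue n i p.
Proof.
move=> ilen /eqP ti; have tP := monotone_entry t; have [tb tm] := tP.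
have FP : monotone_fun i (entry (val t)).
  split=> a b b0 ba ai; last by apply: tm => //; lia.
  have := tb a b b0 ba ltac:(lia).
  have := monotone_fixed_above tP ti b0 ba ai ilen; lia.
pose G a b := entry (val t) (i + a) (i + b) - i.
have GE a b : 0 < b -> b <= a -> i + a <= n -> i + b <= entry (val t) (i + a) (i + b).
  by move=> b0 ba ia; apply: (monotone_ge_col tP); lia.
have GP : monotone_fun (n - i) G.
  split=> a b b0 ba ai; rewrite /G.
    have := tb (i + a) (i + b) ltac:(lia) ltac:(lia) ltac:(lia).
    by have := GE a b b0 ba ltac:(lia); lia.
  have [] := tm (i + a) (i + b) ltac:(lia) ltac:(lia) ltac:(lia).
  have := GE a b b0 ltac:(lia) ltac:(lia).
  have := GE a b.+1 ltac:(lia) ltac:(lia) ltac:(lia).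
  have := GE a.-1 b b0 ltac:(lia) ltac:(lia).
  have -> : (i + a).-1 = i + a.-1 by lia.
  have -> : (i + b).+1 = i + b.+1 by lia.
  by move=> *; split; lia.
exists (triangle_of i (entry (val t)), triangle_of (n - i) G).
apply: triangle_ext => a b b0 ba an; rewrite entry_glue // /glue_fun /=.
case: (leqP a i) => ai; first by rewrite entry_triangle_of.
case: (leqP b i) => bi; first by rewrite (monotone_fixed_below tP ti) //; lia.
rewrite entry_triangle_of //; try lia.
have := monotone_ge_col tP b0 ba an.
by rewrite /G (subnKC (ltnW ai)) (subnKC (ltnW bi)) => /(leq_trans (ltnW bi)) /subnKC ->.
Qed.

(** Cut at row [i]: the lower triangle is unconstrained, since beyond [i] the predicate can only ask
    for row [n], which is always a block. *)
Lemma block_count_split n i (P : pred nat) : i <= n -> P i ->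
  (forall j, i < j < n -> ~~ P j) ->
  block_count n P = block_count i P * A (n - i).
Proof.
move=> ilen Pi Pn; rewrite /block_count /A -cardsT -cardsX.
rewrite -(card_imset _ (glue_inj ilen)); apply: eq_card => t.
apply/idP/imsetP => [|[p]]; rewrite !inE.
  move=> /forallP tP.
  have ti : block t i.
    by have := implyP (tP (inord i)); rewrite inordK ?ltnS //; apply.
  have [p tE] := glue_onto ilen ti; exists p => //.
  rewrite !inE andbT; apply/forallP => j; apply/implyP => Pj.
  have jn : j <= n by rewrite (leq_trans _ ilen) // -ltnS.
  rewrite -(block_glue p ilen) -?tE ?leq_ord //.
  by have := implyP (tP (inord j)); rewrite inordK ?ltnS //; apply.
rewrite andbT => /forallP pP ->; apply/forallP => j; apply/implyP => Pj.
case: (leqP j i) => ji.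
  rewrite block_glue //.
  by have := implyP (pP (inord j)); rewrite inordK ?ltnS //; apply.
have := Pn j; rewrite ji /= Pj; case: ltnP => [_ /(_ isT) //|nj _].
have -> : nat_of_ord j = n by have := leq_ord j; lia.
exact: block_size.
Qed.

(** * Growth of [A] *)

Lemma A_gt0 n : 0 < A n.
Proof. by apply/card_gt0P; exists (tau_min n). Qed.

Lemma A_0 : A 0 = 1.
Proof.
apply/eqP; rewrite eqn_leq A_gt0 andbT; apply/card_le1_eqP => s t _ _.
by apply: triangle_ext => i j j0 ji; rewrite leqn0 => /eqP i0; lia.
Qed.

Lemma A_1 : A 1 = 1.
Proof.
apply/eqP; rewrite eqn_leq A_gt0 andbT; apply/card_le1_eqP => s t _ _.
apply: triangle_ext => i j j0 ji i1.
have [sb _] := monotone_entry s; have [tb _] := monotone_entry t.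
by have := sb i j j0 ji i1; have := tb i j j0 ji i1; lia.
Qed.

(** Row 2 must be [1, 2], so the top entry determines the triangle. *)
Lemma A_2 : A 2 <= 2.
Proof.
rewrite -[X in _ <= X]card_bool.
apply: (@leq_card _ _ (fun t : monotone_triangle 2 => entry (val t) 1 1 == 1)).
move=> s t; cbv beta => e; apply: triangle_ext => i j j0 ji i2.
have [sb sm] := monotone_entry s; have [tb tm] := monotone_entry t.
have [? _ _] := sm 2 1 isT isT isT; have [? _ _] := tm 2 1 isT isT isT.
have ? := sb 2 2 isT isT isT; have ? := tb 2 2 isT isT isT.
have ? := sb 1 1 isT isT isT; have ? := tb 1 1 isT isT isT.
have ? := sb 2 1 isT isT isT; have ? := tb 2 1 isT isT isT.
have [i1|i1] : i = 1 \/ i = 2 by lia.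
  have -> : j = 1 by lia.
  rewrite i1; lia.
have [->|->] : j = 1 \/ j = 2 by lia.
  rewrite i1; lia.
rewrite i1; lia.
Qed.

Lemma block_count_none n (P : pred nat) :
  (forall j, 0 < j < n -> ~~ P j) -> block_count n P = A n.
Proof.
move=> Pn; rewrite /block_count /A -cardsT; apply: eq_card => t; rewrite !inE.
apply/forallP => j; apply/implyP => Pj.
have [->|j0] := posnP j; first exact: block0.
have := Pn j; rewrite j0 /= Pj; case: ltnP => [_ /(_ isT) //|nj _].
have -> : nat_of_ord j = n by have := leq_ord j; lia.
exact: block_size.
Qed.

Lemma block_count1 n i : i <= n -> block_count n (pred1 i) = A i * A (n - i).
Proof.
move=> ilen; rewrite (block_count_split ilen) /= ?eqxx //; last by lia.
by rewrite block_count_none // => j; rewrite /=; lia.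
Qed.

Lemma block_count2 n i j : i <= j -> j <= n ->
  block_count n (predU (pred1 i) (pred1 j)) = A i * A (j - i) * A (n - j).
Proof.
move=> ij jn; rewrite (block_count_split jn) /= ?eqxx ?orbT //; last first.
  by move=> k /=; lia.
rewrite (block_count_split ij) /= ?eqxx //; last by move=> k /=; lia.
by rewrite block_count_none // => k; rewrite /=; lia.
Qed.

(** Correlation of the blocks [y] and [x + y] in size [x + y + z]; the common factor [A y * A z]
    cancels. *)
Lemma A_log_convex x y z : A (x + y) * A (x + z) <= A x * A (x + y + z).
Proof.
have := block_correlation (x + y + z) (pred1 y) (pred1 (x + y)).
rewrite !block_count1 ?block_count2; try lia.
have -> : x + y + z - y = x + z by lia.
have -> : x + y + z - (x + y) = z by lia.
have -> : x + y - y = x by lia.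
have := A_gt0 y; have := A_gt0 z.
move: (A y) (A z) (A x) (A (x + z)) (A (x + y)) (A (x + y + z)) => u v X a b c v0 u0 h.
have uv0 : 0 < u * v by rewrite muln_gt0 u0 v0.
rewrite -(leq_pmul2l uv0); lia.
Qed.

Lemma A_pred a b : 0 < a -> 0 < b -> A a * A b <= A (a + b).-1.
Proof.
case: a => // a _; case: b => // b _.
have := A_log_convex 1 a b; rewrite A_1 mul1n !add1n; congr (_ <= A _); lia.
Qed.

Lemma A_homo : {homo A : m n / m <= n}.
Proof.
apply: homo_leq => // [? ? ?|n]; first exact: leq_trans.
by have := A_log_convex 0 n 1; rewrite A_0 A_1 !add0n mul1n muln1 addn1.
Qed.

Lemma A_ratio_homo k n : k <= n -> A k.+1 * A n <= A k * A n.+1.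
Proof.
move=> kn; have := A_log_convex k 1 (n - k).
by rewrite addn1 addSn subnKC.
Qed.

(** By log-convexity, the product grows as two arguments with fixed sum move apart. *)
Lemma A_extremal k a b : k <= a -> k <= b -> A a * A b <= A k * A (a + b - k).
Proof.
move=> ka kb; have := A_log_convex k (a - k) (b - k).
by rewrite !subnKC // addnBA.
Qed.

(** Split at the largest interior row of [P] and use induction on the upper triangle. Merging the
    two factors by [A_pred] lowers the size by one, which pays for that row. *)
Lemma block_count_le n (P : pred nat) :
  block_count n P <= A (n - \sum_(1 <= k < n) P k).
Proof.
elim/ltn_ind: n => n IHn.
have [/existsP[i0 Pi0]|] := boolP [exists i : 'I_n, (0 < i) && P i]; last first.
  rewrite negb_exists => /forallP none.
  have Pn j : 0 < j < n -> ~~ P j.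
    by move=> /andP[j0 jn]; have := none (Ordinal jn); rewrite /= j0.
  rewrite block_count_none // big_nat big1 ?subn0 // => j /Pn.
  by move/negbTE ->.
pose i := [arg max_(i > i0 | (0 < i) && P i) (i : nat)].
have [Pi imax] : ((0 < i) && P i) /\ forall j : 'I_n, (0 < j) && P j -> j <= i.
  by rewrite /i; case: arg_maxnP.
have /andP[i_gt0 {}Pi] := Pi.
have iltn : i < n by [].
have Pn j : i < j < n -> ~~ P j.
  move=> /andP[ij jn]; apply/negP => Pj.
  by have := imax (Ordinal jn); rewrite /= Pj andbT (leq_ltn_trans _ ij) // leqNgt ij => /(_ isT).
rewrite (block_count_split (ltnW iltn) Pi Pn).
apply: leq_trans (leq_mul (IHn i iltn) (leqnn _)) _.
(* Strictness keeps the argument of the first factor positive, as [A_pred] requires. *)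
have sum_le : \sum_(1 <= k < i) P k < i.
  have : \sum_(1 <= k < i) P k <= \sum_(1 <= k < i) 1 by apply: leq_sum => k _; case: (P k).
  by rewrite sum_nat_const_nat; lia.
rewrite [X in _ <= A (n - X)](big_cat_nat (n := i)) //=; last exact: ltnW.
rewrite [X in _ <= A (n - (_ + X))]big_ltn // Pi.
rewrite [X in _ <= A (n - (_ + (_ + X)))]big_nat [X in _ <= A (n - (_ + (_ + X)))]big1; last first.
  by move=> j /Pn /negbTE ->.
move: sum_le; move: (\sum_(1 <= k < i) P k) => s sum_le.
by apply: leq_trans (A_pred _ _) _; [lia | lia | apply: A_homo; lia].
Qed.

(* Around the plane [2 j - i + k] every constraint has slack one, so that each
   entry away from the boundary can be raised independently. *)
Definition wiggle_fun n k (W : nat -> nat -> bool) (i j : nat) : nat :=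
  maxn j (minn (n - i + j) (2 * j + k - i + W i j)).

Lemma monotone_wiggle n k W : monotone_fun n (wiggle_fun n k W).
Proof.
split=> i j j0 ji ilen; rewrite /wiggle_fun; first by case: (W i j); lia.
by case: (W i j); case: (W i j.+1); case: (W i.-1 j); split; lia.
Qed.

(** The square of rows [k + 1] to [2 * k] and columns 1 to [k] stays clear of both truncations in
    [wiggle_fun], so its [k ^ 2] bits can be read off the triangle. *)
Lemma A_quadratic n k : 4 * k < n -> 2 ^ (k ^ 2) <= A n.
Proof.
move=> kn.
pose W (w : {ffun 'I_k * 'I_k -> bool}) (i j : nat) :=
  [exists p : 'I_k * 'I_k, [&& i == k + p.1.+1, j == p.2.+1 & w p]].
have WE w (p : 'I_k * 'I_k) : W w (k + p.1.+1) p.2.+1 = w p.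
  apply/existsP/idP => [[q /and3P[/eqP e1 /eqP e2 wq]]|wp]; last first.
    by exists p; rewrite !eqxx.
  suff -> : p = q by [].
  case: p q e1 e2 {wq} => [p1 p2] [q1 q2] /= e1 e2.
  by congr (_, _); apply/val_inj => /=; lia.
have -> : 2 ^ (k ^ 2) = #|{ffun 'I_k * 'I_k -> bool}|.
  by rewrite card_ffun card_bool card_prod card_ord -mulnn.
apply: (@leq_card _ _ (fun w => triangle_of n (wiggle_fun n (2 * k) (W w)))).
move=> w w' e; apply/ffunP => p; rewrite -!WE.
have h1 : 0 < p.2.+1 by [].
have h2 : p.2.+1 <= k + p.1.+1 by have := ltn_ord p.2; lia.
have h3 : k + p.1.+1 <= n by have := ltn_ord p.1; lia.
have hw := entry_triangle_of (monotone_wiggle n (2 * k) (W w)) h1 h2 h3.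
have hw' := entry_triangle_of (monotone_wiggle n (2 * k) (W w')) h1 h2 h3.
have := etrans (esym hw)
  (etrans (congr1 (fun t => entry (val t) (k + p.1.+1) p.2.+1) e) hw').
rewrite /wiggle_fun; have := ltn_ord p.1; have := ltn_ord p.2; clear -kn.
move: (nat_of_ord p.1) (nat_of_ord p.2) (W w _ _) (W w' _ _) => x y u v.
by case: u; case: v => //= *; lia.
Qed.

(** If the last ratio were below [2 ^ q], then by log-convexity so would be all earlier ones up to
    equality, and [A n < 2 ^ (q * n)] would contradict [A_quadratic]. *)
Lemma A_growth n : 16 <= n -> 2 ^ (n %/ 32) * A n.-1 <= A n.
Proof.
move=> n16; rewrite leqNgt; apply/negP => small.
set q := n %/ 32 in small.
have step k : k < n -> A k.+1 <= 2 ^ q * A k.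
  move=> kn; have := @A_ratio_homo k n.-1 ltac:(lia).
  rewrite prednK; last by lia.
  move=> h; rewrite -(leq_pmul2r (A_gt0 n.-1)).
  apply: leq_trans h _; by rewrite -mulnA mulnCA leq_mul2l (ltnW small) orbT.
have up k : k <= n.-1 -> A k <= 2 ^ (q * k).
  elim: k => [|k IHk] kn; first by rewrite A_0 muln0.
  apply: leq_trans (step k ltac:(lia)) _.
  by rewrite mulnS expnD leq_mul2l IHk ?orbT //; lia.
have := @A_quadratic n (n.-1 %/ 4) ltac:(lia).
apply/negP; rewrite -ltnNge; apply: leq_trans small _.
apply: leq_trans (leq_mul (leqnn _) (up _ (leqnn _))) _.
rewrite -expnD leq_exp2l // -mulnS prednK; last by lia.
(* With [k = n.-1 %/ 4], this gives [q * n <= (k + 1) ^ 2 / 2], which is at most [k ^ 2] once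
   [3 <= k]; hence the constants 32 and 16. *)
have q_le : 8 * q <= (n.-1 %/ 4).+1 by rewrite /q; lia.
have k_ge : n <= 4 * (n.-1 %/ 4).+1 by lia.
have k3 : 3 <= n.-1 %/ 4 by lia.
rewrite -mulnn; move: (n.-1 %/ 4) q_le k_ge k3 => k q_le k_ge k3.
apply: leq_trans (_ : q * (4 * k.+1) <= _); first by rewrite leq_mul2l k_ge orbT.
nia.
Qed.

(** Induction on the degree by halving [q]: one half of the exponent absorbs one linear factor, the
    other half the rest. *)
Lemma poly_le_exp C k : exists q0, forall q, q0 <= q -> C * q.+1 ^ k <= 2 ^ q.
Proof.
elim: k C => [|k IHk] C.
  exists C => q Cq; rewrite muln1; apply: leq_trans (ltnW (ltn_expl C (ltnSn 1))) _.
  by rewrite leq_exp2l.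
have [q0 hq0] := IHk (C * 2 ^ k.+1); exists (2 * q0).+1 => q qq0.
have h := hq0 q./2 ltac:(lia).
apply: leq_trans (_ : C * (2 * q./2.+1) ^ k.+1 <= _).
  rewrite leq_mul2l leq_exp2r //; lia.
rewrite expnMn expnSr [(q./2.+1) ^ _]expnSr.
apply: leq_trans (_ : 2 ^ q./2 * 2 ^ q./2 <= _).
  rewrite [X in X <= _](_ : _ = C * 2 ^ k.+1 * (q./2).+1 ^ k * (q./2).+1).
    by apply: leq_mul => //; apply: ltn_expl.
  by rewrite expnSr !mulnA; lia.
by rewrite -expnD leq_exp2l //; lia.
Qed.

Lemma A_poly_growth C k :
  exists n0, forall n, n0 <= n -> C * n.+1 ^ k * A n.-1 <= A n.
Proof.
have [q0 hq0] := poly_le_exp (C * 32 ^ k) k.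
exists (32 * q0 + 16) => n nn0.
apply: leq_trans (A_growth (n := n) ltac:(lia)); rewrite leq_mul2r; apply/orP; right.
apply: leq_trans (hq0 (n %/ 32) ltac:(lia)).
by rewrite -mulnA -expnMn leq_mul2l; apply/orP; right; case: k {hq0} => [//|k]; rewrite leq_exp2r //; lia.
Qed.

(** [K] is chosen before [C], because the later use takes a [C] that itself depends on [K]. *)
Lemma A_exp_growth q : exists K, forall C, exists n0, forall n, n0 <= n ->
  C * q ^ n * A (n - K) <= A n.
Proof.
(* [K] steps, each of ratio at least [2 ^ ((n - K) %/ 32)], gain an exponent of at least
   [2 * q.+1 * (n - K - 31)], against [C * q ^ n <= 2 ^ (C + q * n)]. *)
pose K := 64 * q.+1; exists K => C; exists (C + 2 * q.+1 * (K + 31) + 16) => n nn0.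
have step k : n - K + k <= n -> 2 ^ (k * ((n - K) %/ 32)) * A (n - K) <= A (n - K + k).
  elim: k => [|k IHk] h; first by rewrite mul0n mul1n addn0.
  apply: leq_trans (A_growth (n := n - K + k.+1) ltac:(lia)).
  rewrite mulSn expnD -mulnA; apply: leq_mul; first by rewrite leq_exp2l //; lia.
  by rewrite addnS /=; apply: IHk; lia.
have := step K; rewrite subnK; last by lia.
move=> /(_ (leqnn _)); apply: leq_trans; rewrite leq_mul2r; apply/orP; right.
have h1 : C * q ^ n <= 2 ^ (C + q * n).
  rewrite expnD expnM; apply: leq_mul; first exact: ltnW (ltn_expl _ _).
  by case: n {nn0 step} => // n; rewrite leq_exp2r //; apply: ltnW; apply: ltn_expl.
apply: leq_trans h1 _; rewrite leq_exp2l //.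
have h2 : n <= K + 31 + 32 * ((n - K) %/ 32) by lia.
have h3 : C + 2 * q.+1 * (K + 31) <= n by lia.
move: h2 h3; rewrite {2}/K; move: ((n - K) %/ 32) (K + 31) => x y h2 h3.
nia.
Qed.

(** * Rows fixed by a triangle *)

Definition blocks n (t : monotone_triangle n) : {set 'I_n.+1} :=
  [set i : 'I_n.+1 | block t i].

(** Rows 0 and [n] are always blocks, so complements of block sets avoid both. *)
Definition interior n (U : {set 'I_n.+1}) : bool :=
  (ord0 \notin U) && (ord_max \notin U).

Lemma superset_count_blocks n (U : {set 'I_n.+1}) :
  superset_count (@blocks n) U = block_count n (fun k => inord k \in U).
Proof.
apply: eq_card => t; rewrite !inE.
apply/subsetP/forallP => [h i|h i iU].
  by rewrite inord_val; apply/implyP => /h; rewrite inE.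
by have := h i; rewrite inord_val iU inE.
Qed.

Lemma eq_block_count n (P Q : pred nat) :
  (forall k, k <= n -> P k = Q k) -> block_count n P = block_count n Q.
Proof.
move=> PQ; apply: eq_card => t; rewrite !inE.
by apply: eq_forallb => i; rewrite PQ // leq_ord.
Qed.

Lemma blocks_correlation n (S T : {set 'I_n.+1}) :
  superset_count (@blocks n) S * superset_count (@blocks n) T <=
  superset_count (@blocks n) (S :|: T) * #|monotone_triangle n|.
Proof.
rewrite !superset_count_blocks; apply: leq_trans (block_correlation _ _ _) _.
rewrite leq_mul2r; apply/orP; right; apply: eq_leq; apply: eq_block_count => k _.
by rewrite /= in_setU.
Qed.

Lemma interior_sum n (U : {set 'I_n.+1}) : interior U ->
  \sum_(1 <= k < n) (inord k \in U : nat) = #|U|.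
Proof.
move=> /andP[U0 Un].
have -> : #|U| = \sum_(0 <= k < n.+1) (inord k \in U : nat).
  rewrite big_mkord -sum1_card big_mkcond; apply: eq_bigr => i _.
  by rewrite inord_val; case: (i \in U).
have [n0|n0] := posnP n.
  subst n; rewrite big_nat1 big_geq //.
  have -> : inord 0 = ord0 :> 'I_1 by apply/val_inj; rewrite /= inordK.
  by rewrite (negbTE U0).
rewrite [RHS]big_nat_recr //= [X in _ = X + _]big_ltn //.
have -> : inord 0 = ord0 :> 'I_n.+1 by apply/val_inj; rewrite /= inordK.
have -> : inord n = ord_max :> 'I_n.+1 by apply/val_inj; rewrite /= inordK.
by rewrite (negbTE U0) (negbTE Un) addn0.
Qed.

Lemma superset_count_le n (U : {set 'I_n.+1}) : interior U ->
  superset_count (@blocks n) U <= A (n - #|U|).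
Proof.
by move=> /interior_sum <-; rewrite superset_count_blocks block_count_le.
Qed.

Lemma superset_count1 n (i : 'I_n.+1) :
  superset_count (@blocks n) [set i] = A i * A (n - i).
Proof.
rewrite superset_count_blocks -block_count1 ?leq_ord //; apply: eq_block_count => k kn.
by rewrite inE -val_eqE /= inordK.
Qed.

Lemma superset_count2 n (i j : 'I_n.+1) : i <= j ->
  superset_count (@blocks n) [set i; j] = A i * A (j - i) * A (n - j).
Proof.
move=> ij; rewrite superset_count_blocks -block_count2 ?leq_ord //.
by apply: eq_block_count => k kn; rewrite !inE -!val_eqE /= inordK.
Qed.

Lemma superset_count_mem n (U : {set 'I_n.+1}) i : i \in U ->
  superset_count (@blocks n) U <= A i * A (n - i).
Proof.
move=> iU; rewrite -superset_count1; apply: subset_leq_card; apply/subsetP => t.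
rewrite !inE sub1set => /subsetP; exact.
Qed.

Lemma interior_blocksC n (t : monotone_triangle n) : interior (~: blocks t).
Proof. by rewrite /interior !inE block0 block_size. Qed.

Lemma block_tau_min n i : i <= n -> block (tau_min n) i.
Proof.
move=> ilen; have [->|i0] := posnP i; first exact: block0.
have [c [ci cj]] := cellP i0 (leqnn i) ilen.
by rewrite /block -{1}ci -{1}cj entry_cell ffunE cj.
Qed.

Definition blocksC_count n (U : {set 'I_n.+1}) : nat :=
  #|[set t : monotone_triangle n | ~: blocks t == U]|.

(** Take for [V] the rows from 1 to [n - 1] outside [U]; there are [n - 1 - #|U|] of them. *)
Lemma blocksC_count_sub n (U : {set 'I_n.+1}) : 0 < n -> interior U ->
  exists2 V : {set 'I_n.+1}, superset_count (@blocks n) V <= A #|U|.+1 &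
    [set t : monotone_triangle n | ~: blocks t == U] \subset
    [set t | V \subset blocks t].
Proof.
move=> n0 Uint; have /andP[U0 Un] := Uint.
pose V := ~: (ord0 |: (ord_max |: U)).
have Vint : interior V by rewrite /interior !inE !eqxx ?orbT.
have cardV : #|V| + #|U|.+2 = n.+1.
  rewrite -[RHS](card_ord n.+1) -(cardsC V) setCK; congr (_ + _).
  rewrite cardsU1 cardsU1 Un /= inE (negbTE U0) orbF.
  have -> : (ord0 \notin [set ord_max : 'I_n.+1]) = true.
    by rewrite inE -val_eqE /=; lia.
  by [].
exists V.
  apply: leq_trans (superset_count_le Vint) (A_homo _).
  by rewrite leq_subLR -ltnS -addnS cardV.
apply/subsetP => t; rewrite !inE => /eqP tU; apply/subsetP => i.
by rewrite -[blocks t]setCK tU !inE !negb_or => /and3P[].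
Qed.

Lemma blocksC_count_le n (U : {set 'I_n.+1}) : 0 < n -> interior U ->
  blocksC_count U <= A #|U|.+1.
Proof.
move=> n0 Uint; have [V hV sV] := blocksC_count_sub n0 Uint.
exact: leq_trans (subset_leq_card sV) hV.
Qed.

(** [tau_min] also has the required blocks but misses none. For a singleton [U], with [A_2], this
    leaves at most one triangle, as the exact second term demands. *)
Lemma blocksC_count_lt n (U : {set 'I_n.+1}) : 0 < n -> interior U ->
  U != set0 -> blocksC_count U < A #|U|.+1.
Proof.
move=> n0 Uint Un0; have [V hV sV] := blocksC_count_sub n0 Uint.
apply: leq_trans hV; apply: proper_card; rewrite properE sV /=.
apply/subsetPn; exists (tau_min n); rewrite !inE.
  by apply/subsetP => i _; rewrite inE block_tau_min // leq_ord.
apply: contra_neq Un0 => <-; apply/setP => i.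
by rewrite !inE block_tau_min // leq_ord.
Qed.

Lemma monotone_bump n (P : pred nat) : (forall i, P i -> i < n) ->
  monotone_fun n (fun i j => if (i == j) && P i then j.+1 else j).
Proof.
move=> Pn; split=> i j j0 ji ilen.
  by have := Pn i; case: eqP => [<-|] /=; case: (P i) => //=; lia.
split; case: eqP => //= *; repeat case: ifP => //= *; lia.
Qed.

(** Raising the last entry of exactly the rows in [U] gives a witness with prescribed non-block
    rows. *)
Definition bump_triangle n (U : {set 'I_n.+1}) : monotone_triangle n :=
  triangle_of n (fun i j => if (i == j) && ((i < n) && (inord i \in U)) then j.+1 else j).

Lemma blocksC_bump n (U : {set 'I_n.+1}) : interior U -> ~: blocks (bump_triangle U) = U.
Proof.
move=> /andP[U0 Un]; apply/setP => i; rewrite !inE.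
have [i0|i0] := posnP i.
  have -> : i = ord0 by apply/val_inj.
  by rewrite block0 (negbTE U0).
rewrite /block entry_triangle_of ?leq_ord //.
  rewrite eqxx inord_val /=; case: (ltnP i n) => /= iln; last first.
    have -> : i = ord_max by apply/val_inj => /=; have := leq_ord i; lia.
    by rewrite eqxx (negbTE Un).
  by case: ifP => _; rewrite ?eqxx ?neq_ltn ?ltnSn ?orbT.
by apply: monotone_bump => k /andP[].
Qed.

Lemma inf_triangle_covers n r (w : {ffun 'I_r -> monotone_triangle n}) : 0 < r ->
  (inf_triangle w == val (tau_min n)) = covers (@blocks n) w [set: 'I_n.+1].
Proof.
move=> r0; apply/eqP/coversP => [e i _|h].
  have [i0|i0] := posnP i.
    by exists (Ordinal r0); rewrite inE i0 block0.
  (* Row [n] is separate: elsewhere the value [i < n] differs from the default [ord_max], so the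
     minimum is attained by some [w k]. *)
  have [iE|iltn] : i = n :> nat \/ i < n by have := leq_ord i; lia.
    by exists (Ordinal r0); rewrite inE iE block_size.
  have [c [ci cj]] := cellP i0 (leqnn i) (ltnW iltn).
  have := congr1 (fun f : tri_array n => f c) e; rewrite !ffunE => ec.
  have [h|[k hk]] : \big[Order.min/ord_max]_(k < r) val (w k) c = ord_max
     \/ exists k, \big[Order.min/ord_max]_(k < r) val (w k) c = val (w k) c.
    apply: (big_ind (fun y => y = ord_max \/ exists k, y = val (w k) c)).
    - by left.
    - by move=> x y hx hy; rewrite minElt; case: ifP.
    - by move=> k _; right; exists k.
    by move: h; rewrite ec => /(congr1 val) /=; rewrite cj; lia.
  exists k; rewrite inE /block -{1}ci -{1}cj entry_cell -hk ec cj //.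
apply/ffunP => c; rewrite !ffunE; apply/le_anti/andP; split.
  have /andP[c0 cr] := cell_bounds c.
  have [k] := h (row_of c) (in_setT _); rewrite inE => /eqP bk.
  apply: le_trans (bigmin_le _ k _) _.
  have := monotone_row_fixed (monotone_entry (w k)) bk c0 cr (row_le c).
  by rewrite entry_cell leEord => ->.
apply: (big_ind (fun y => col_of c <= y)%O).
- by rewrite leEord /= leq_ord.
- by move=> x y hx hy; rewrite le_min hx hy.
move=> k _; have /andP[c0 cr] := cell_bounds c.
have := monotone_ge_col (monotone_entry (w k)) c0 cr (row_le c).
by rewrite entry_cell leEord.
Qed.

(** * Upper and lower bounds *)

Lemma cov_blocks_le n m (U : {set 'I_n.+1}) :
  cov (@blocks n) m.+1 U <=
  m.+1 ^ #|U| * superset_count (@blocks n) U * A n ^ m.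
Proof.
have := cov_le (@blocks_correlation n) m.+1 U.
by rewrite -/(A n) expnS mulnCA leq_pmul2l ?A_gt0.
Qed.

Lemma bin_le_expn n k : 'C(n, k) <= n ^ k.
Proof.
apply: leq_trans (leq_pmulr _ (fact_gt0 k)) _; rewrite bin_ffact.
by elim: k => // k IHk; rewrite ffactnSr expnSr leq_mul // leq_subr.
Qed.

Lemma card_small_sets (I : finType) K : 0 < #|I| ->
  #|[set U : {set I} | #|U| < K]| <= #|I|.+1 ^ K.
Proof.
move=> I0; elim: K => [|K IHK].
  by rewrite (eq_card0 (A := [set _ | _])) // => U; rewrite inE ltn0.
have sub : [set U : {set I} | #|U| < K.+1] \subset
    [set U : {set I} | #|U| < K] :|: [set U : {set I} | #|U| == K].
  by apply/subsetP => U; rewrite !inE ltnS leq_eqVlt orbC.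
apply: leq_trans (subset_leq_card sub) _.
apply: leq_trans (leq_card_setU _ _) _.
rewrite card_draws expnSr mulnS; apply: leq_add => //.
apply: leq_trans (bin_le_expn _ _) _.
rewrite -[X in X <= _]muln1; apply: leq_mul => //.
by case: K {IHK sub} => // K; rewrite leq_exp2r.
Qed.

Lemma sum_setU1_le (I : finType) (x : I) (B : {set I}) (F : I -> nat) :
  \sum_(y in x |: B) F y <= F x + \sum_(y in B) F y.
Proof.
case: (boolP (x \in B)) => xB; last by rewrite big_setU1.
by rewrite (setUidPr _) ?sub1set // leq_addl.
Qed.

Definition trivial_sets n : {set {set 'I_n.+1}} :=
  [set set0; [set inord 1]; [set inord (n - 1)]].

Lemma remaining_sets_sum m : exists C n0, forall n, n0 <= n ->
  \sum_(U : {set 'I_n.+1} |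
      [&& interior U, n.+1 <= m.+2 * #|~: U| & U \notin trivial_sets n])
    A #|U|.+1 * (m.+1 ^ #|U| * superset_count (@blocks n) U) <= C * A (n - 2).
Proof.
have [K0 hK0] := A_exp_growth (2 * m.+2).
pose K := K0 + 3.
(* Both growth bounds are applied at [n - 2]. The shift costs three factors [2 * m.+2] here, and the
   factor [4 ^ K] in the next bound comes from [n + 2 <= 4 * (n - 1)]. *)
have [n1 hn1] := hK0 ((2 * m.+2) ^ 3 * A K).
have [n2 hn2] := A_poly_growth (A K * m.+2 ^ K * A 3 * 4 ^ K) K.
exists (16 * (A 5 * m.+2 ^ 4 * 2) + 2), (n1 + n2 + 10 + m.+2 * (K + 2)) => n nn0.
pose i1 : 'I_n.+1 := inord 1; pose i2 : 'I_n.+1 := inord 2.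
pose i3 : 'I_n.+1 := inord (n - 2); pose i4 : 'I_n.+1 := inord (n - 1).
have i1E : i1 = 1 :> nat by rewrite inordK //; lia.
have i2E : i2 = 2 :> nat by rewrite inordK //; lia.
have i3E : i3 = n - 2 :> nat by rewrite inordK //; lia.
have i4E : i4 = n - 1 :> nat by rewrite inordK //; lia.
pose E4 : {set 'I_n.+1} := [set i1; i2; i3; i4].
have cardE4 : #|E4| <= 4.
  rewrite /E4 -!setUA.
  do 3!(apply: leq_trans (leq_card_setU _ _) _; rewrite cards1 leq_add2l).
  by rewrite cards1.
(* Bounds for one set [U]: [X1] inside [E4] (at most 16 sets), [X2] for other sets of size below [K]
   (polynomially many), and [X3] for the rest (at most [2 ^ n.+1]). *)
pose X1 := A 5 * (m.+2 ^ 4 * (2 * A (n - 2))).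
pose X2 := A K * (m.+2 ^ K * (A 3 * A (n - 3))).
pose X3 := m.+2 ^ n.+1 * (A K * A (n + 1 - K)).
have bound U : [&& interior U, n.+1 <= m.+2 * #|~: U| & U \notin trivial_sets n] ->
    A #|U|.+1 * (m.+1 ^ #|U| * superset_count (@blocks n) U) <=
    (U \subset E4) * X1 + (#|U| < K) * X2 + X3.
  case/and3P => Uint Ularge Unt.
  have expm k u : u <= k -> m.+1 ^ u <= m.+2 ^ k.
    by move=> uk; apply: leq_trans (leq_pexp2l _ uk) _ => //; case: (k) => // k'; rewrite leq_exp2r.
  case: (boolP (U \subset E4)) => [UE4|/subsetPn[i iU iE4]].
    have U4 : #|U| <= 4 := leq_trans (subset_leq_card UE4) cardE4.
    rewrite mul1n -addnA; apply: leq_trans (leq_addr _ _).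
    apply: leq_mul; first by apply: A_homo.
    apply: leq_mul; first exact: expm.
    have A22 := A_2.
    (* Row 2 or [n - 2] in [U] gives the bound [A 2 * A (n - 2)]. Otherwise [U], not being trivial,
       contains both 1 and [n - 1], and its size gives [A (n - 2)]. *)
    case: (boolP (i2 \in U)) => [/superset_count_mem h|i2U].
      apply: leq_trans h _; rewrite i2E; exact: leq_mul.
    case: (boolP (i3 \in U)) => [/superset_count_mem h|i3U].
      apply: leq_trans h _; rewrite i3E mulnC subKn; last by lia.
      exact: leq_mul.
    have Usub j : j \in U -> j \in [set i1; i4].
      move=> jU; have := subsetP UE4 j jU; rewrite !inE.
      case/orP => [/orP[/orP[|]|]|] /eqP e; subst j; rewrite ?eqxx ?orbT //.
        by rewrite jU in i2U.
      by rewrite jU in i3U.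
    have i1U : i1 \in U.
      apply: contraR Unt => i1U; have : U \subset [set i4].
        apply/subsetP => j jU; have := Usub j jU; rewrite !inE.
        by case/orP => // /eqP e; rewrite -e jU in i1U.
      by rewrite subset1 !inE => /orP[] /eqP ->; rewrite eqxx ?orbT.
    have i4U : i4 \in U.
      apply: contraR Unt => i4U; have : U \subset [set i1].
        apply/subsetP => j jU; have := Usub j jU; rewrite !inE.
        by case/orP => // /eqP e; rewrite -e jU in i4U.
      by rewrite subset1 !inE => /orP[] /eqP ->; rewrite eqxx ?orbT.
    have U2 : 2 <= #|U|.
      have <- : #|[set i1; i4]| = 2.
        by rewrite cards2 -val_eqE /= i1E i4E; have -> : 1 != n - 1 by lia.
      by apply: subset_leq_card; apply/subsetP => j; rewrite !inE => /orP[] /eqP ->.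
    apply: leq_trans (superset_count_le Uint) _.
    apply: leq_trans (_ : A (n - 2) <= _); last by rewrite leq_pmull.
    by apply: A_homo; rewrite leq_sub2l.
  rewrite mul0n add0n.
  case: ltnP => UK.
    rewrite mul1n; apply: leq_trans (leq_addr _ _).
    apply: leq_mul; first by apply: A_homo.
    apply: leq_mul; first by apply: expm; apply: ltnW.
    apply: leq_trans (superset_count_mem iU) _.
    have ile := leq_ord i.
    (* An interior row outside [E4] is at distance at least 3 from both ends, so [A_extremal] gives
       [A 3 * A (n - 3)]. *)
    have [i_ge i_le] : 3 <= i /\ i <= n - 3.
      have /andP[U0 Un] := Uint.
      have ne0 : i != 0 :> nat.
        by apply: contraNneq U0 => e; have <- : i = ord0 by apply/val_inj.
      have nen : i != n :> nat.
        by apply: contraNneq Un => e; have <- : i = ord_max by apply/val_inj.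
      by move: iE4; rewrite !inE -!val_eqE /= i1E i2E i3E i4E; lia.
    have := @A_extremal 3 i (n - i) i_ge ltac:(lia).
    by rewrite subnKC.
  (* Both [#|U|.+1] and [n - #|U|] are at least [K], the latter because the complement of [U] is
     large, so [A_extremal] applies at [K]. *)
  rewrite mul0n add0n /X3 mulnCA.
  apply: leq_mul; first by apply: expm; rewrite -[X in _ <= X](card_ord n.+1) max_card.
  apply: leq_trans (leq_mul (leqnn _) (superset_count_le Uint)) _.
  have cardU : #|U| + #|~: U| = n.+1 by rewrite cardsC card_ord.
  have UCK : K + 2 <= #|~: U|.
    rewrite -(leq_pmul2l (ltn0Sn m.+1)); apply: leq_trans Ularge; lia.
  move: cardU UCK UK; move: #|U| #|~: U| => u v cardU UCK UK.
  have := @A_extremal K u.+1 (n - u) ltac:(lia) ltac:(lia).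
  by have -> : u.+1 + (n - u) - K = n + 1 - K by lia.
apply: leq_trans (leq_sum _ bound) _.
apply: leq_trans (_ : \sum_(U : {set 'I_n.+1})
   ((U \subset E4) * X1 + (#|U| < K) * X2 + X3) <= _).
  rewrite [X in _ <= X](bigID (fun U =>
    [&& interior U, n.+1 <= m.+2 * #|~: U| & U \notin trivial_sets n])).
  exact: leq_addr.
rewrite !big_split /= -!big_distrl /= sum_nat_const.
have S1 : \sum_(U : {set 'I_n.+1}) (U \subset E4) <= 16.
  apply: leq_trans (_ : 2 ^ #|E4| <= _); last by rewrite -[16]/(2 ^ 4) leq_exp2l.
  rewrite -card_powerset -sum1_card [X in _ <= X]big_mkcond; apply: leq_sum => U _.
  by rewrite inE.
have S2 : \sum_(U : {set 'I_n.+1}) (#|U| < K) <= n.+2 ^ K.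
  have := @card_small_sets 'I_n.+1 K; rewrite card_ord => /(_ isT); apply: leq_trans.
  by rewrite -sum1_card [X in _ <= X]big_mkcond; apply: leq_sum => U _; rewrite inE.
have S3 : #|{: {set 'I_n.+1}}| = 2 ^ n.+1.
  by have := card_powerset [set: 'I_n.+1]; rewrite powersetT !cardsT card_ord.
rewrite S3.
have Y2 : n.+2 ^ K * X2 <= A (n - 2).
  apply: leq_trans (hn2 (n - 2) ltac:(lia)).
  have -> : (n - 2).-1 = n - 3 by lia.
  apply: leq_trans (_ : (4 * (n - 2).+1) ^ K * X2 <= _).
    by rewrite leq_mul2r; apply/orP; right; rewrite leq_exp2r //; rewrite /K; lia.
  by rewrite expnMn /X2; apply: eq_leq; lia.
have Y3 : 2 ^ n.+1 * X3 <= A (n - 2).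
  apply: leq_trans (hn1 (n - 2) ltac:(lia)).
  have -> : n - 2 - K0 = n + 1 - K by rewrite /K; lia.
  rewrite /X3 mulnA -expnMn.
  have {1}-> : n.+1 = 3 + (n - 2) by lia.
  by rewrite expnD; apply: eq_leq; lia.
rewrite -[_ * _ * (A K * _)]mulnA -/X3.
apply: leq_trans (leq_add (leq_add (leq_mul S1 (leqnn _)) (leq_mul S2 (leqnn _))) Y3) _.
apply: leq_trans (leq_add (leq_add (leqnn _) Y2) (leqnn _)) _.
by rewrite /X1; lia.
Qed.

Lemma cov_blocks_upper m : exists C n0, forall n, n0 <= n ->
  cov (@blocks n) m.+2 [set: 'I_n.+1] <=
  m.+2 * A n ^ m.+1 + 2 * m.+2 * m.+1 * A (n - 1) * A n ^ m +
  C * (A (n - 2) * A n ^ m).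
Proof.
have [C [n0 hC]] := remaining_sets_sum m.
exists (m.+2 * C), (n0 + 3) => n nn0.
apply: leq_trans (cov_upper _ _) _.
have n_gt0 : 0 < n by lia.
pose cond (U : {set 'I_n.+1}) := interior U && (n.+1 <= m.+2 * #|~: U|).
pose X (U : {set 'I_n.+1}) := blocksC_count U * cov (@blocks n) m.+1 U.
have step : \sum_(t | #|'I_n.+1| <= m.+2 * #|blocks t|) cov (@blocks n) m.+1 (~: blocks t)
    <= \sum_(U | cond U) X U.
  rewrite (partition_big (fun t => ~: blocks t) cond) /=; last first.
    by move=> t; rewrite card_ord /cond setCK => ->; rewrite interior_blocksC.
  apply: leq_sum => U _.
  rewrite (eq_bigr (fun _ => cov (@blocks n) m.+1 U)); last by move=> t /andP[_ /eqP ->].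
  rewrite sum_nat_const leq_mul2r; apply/orP; right; apply: subset_leq_card.
  by apply/subsetP => t; rewrite !inE => /andP[].
(* Only one triangle can miss exactly this row, and [A 1 = 1] makes the superset count
   [A (n - 1)]. *)
have small i : 0 < i < n -> i = 1 \/ i = n - 1 ->
    X [set (inord i : 'I_n.+1)] <= m.+1 * A (n - 1) * A n ^ m.
  move=> /andP[i0 iltn] i1; rewrite /X.
  have iE : (inord i : 'I_n.+1) = i :> nat by rewrite inordK //; lia.
  have Uint : interior [set (inord i : 'I_n.+1)].
    by rewrite /interior !inE -!val_eqE /= iE; lia.
  have U0 : [set (inord i : 'I_n.+1)] != set0.
    by apply/set0Pn; exists (inord i); rewrite inE.
  have := blocksC_count_lt n_gt0 Uint U0; rewrite cards1 => h.
  have h1 : blocksC_count [set (inord i : 'I_n.+1)] <= 1 := leq_trans h A_2.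
  apply: leq_trans (leq_mul h1 (cov_blocks_le _ _)) _.
  rewrite mul1n cards1 expn1 superset_count1 iE -[X in _ <= X]mulnA -mulnA.
  apply: eq_leq; congr (_ * (_ * _)).
  case: i1 => ->; first by rewrite A_1 mul1n.
  by rewrite subKn ?A_1 ?muln1.
have zero : X set0 <= A n ^ m.+1.
  rewrite /X cov_set0 -[X in _ <= X]mul1n; apply: leq_mul => //.
  have int0 : interior (set0 : {set 'I_n.+1}) by rewrite /interior !inE.
  by have := blocksC_count_le n_gt0 int0; rewrite cards0 A_1.
have rest : \sum_(U | cond U && (U \notin trivial_sets n)) X U <= C * A (n - 2) * A n ^ m.
  apply: leq_trans (leq_mul (hC n ltac:(lia)) (leqnn _)).
  rewrite big_distrl /= (eq_bigl (fun U =>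
    [&& interior U, n.+1 <= m.+2 * #|~: U| & U \notin trivial_sets n])); last first.
    by move=> U; rewrite /cond andbA.
  apply: leq_sum => U /and3P[Uint _ _]; rewrite -mulnA.
  exact: leq_mul (blocksC_count_le n_gt0 Uint) (cov_blocks_le _ _).
have triv : \sum_(U | cond U && (U \in trivial_sets n)) X U <=
    A n ^ m.+1 + 2 * (m.+1 * A (n - 1) * A n ^ m).
  apply: leq_trans (_ : \sum_(U in trivial_sets n) X U <= _).
    by rewrite [X in _ <= X](bigID cond) /= (eq_bigl _ _ (fun U => andbC _ _)) leq_addr.
  rewrite /trivial_sets -setUA; apply: leq_trans (sum_setU1_le _ _ _) _.
  apply: leq_add => //; apply: leq_trans (sum_setU1_le _ _ _) _.
  rewrite big_set1 mul2n -addnn; apply: leq_add; apply: small; lia.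
apply: leq_trans (leq_mul (leqnn _) step) _.
rewrite (bigID (mem (trivial_sets n))) /=.
apply: leq_trans (leq_mul (leqnn _) (leq_add triv rest)) _.
by apply: eq_leq; lia.
Qed.

(** Bonferroni for five bump triangles. The sets on rows 1 and [n - 1] together give the second term
    without loss by [cov_pair_lower], and the set [{2}] adds [m.+2] copies of
    [A (n - 2) * A n ^ m]. *)
Lemma cov_blocks_lower m : exists n0, forall n, n0 <= n ->
  m.+2 * A n ^ m.+1 + 2 * m.+2 * m.+1 * A (n - 1) * A n ^ m +
  A (n - 2) * A n ^ m <= cov (@blocks n) m.+2 [set: 'I_n.+1].
Proof.
have [n1 hn1] := A_poly_growth (2 * m.+1 ^ 2 + 2 * m.+1) 0.
have [n2 hn2] := A_poly_growth (25 * m.+2) 0.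
exists (n1 + n2 + 10) => n nn0.
pose i1 : 'I_n.+1 := inord 1; pose i2 : 'I_n.+1 := inord (n - 1).
pose i3 : 'I_n.+1 := inord 2.
have i1E : i1 = 1 :> nat by rewrite inordK //; lia.
have i2E : i2 = n - 1 :> nat by rewrite inordK //; lia.
have i3E : i3 = 2 :> nat by rewrite inordK //; lia.
have n12 : i1 == i2 = false by rewrite -val_eqE /= i1E i2E; lia.
have n13 : i1 == i3 = false by rewrite -val_eqE /= i1E i3E.
have n23 : i2 == i3 = false by rewrite -val_eqE /= i2E i3E; lia.
have n21 : i2 == i1 = false by rewrite eq_sym.
have n31 : i3 == i1 = false by rewrite eq_sym.
have n32 : i3 == i2 = false by rewrite eq_sym.
pose S : {set {set 'I_n.+1}} :=
  [set set0; [set i1]; [set i2]; [set i1; i2]; [set i3]].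
have Sint U : U \in S -> interior U.
  rewrite !inE => /orP[/orP[/orP[/orP[]|]|]|] /eqP ->;
    rewrite /interior !inE -?val_eqE /= ?i1E ?i2E ?i3E; lia.
have bump_inj : {in S &, injective (@bump_triangle n)}.
  move=> U V /Sint Ui /Sint Vi e.
  by rewrite -(blocksC_bump Ui) e blocksC_bump.
have := cov_lower (@blocks n) m (@bump_triangle n @: S).
rewrite big_imset // (eq_bigr (fun U => cov (@blocks n) m.+1 U)); last first.
  by move=> U /Sint Ui; rewrite blocksC_bump.
have cardS : #|@bump_triangle n @: S| <= 5.
  apply: leq_trans (leq_imset_card _ _) _; rewrite /S -!setUA.
  do 4!(apply: leq_trans (leq_card_setU _ _) _; rewrite cards1 leq_add2l).
  by rewrite cards1.
have SE : \sum_(U in S) cov (@blocks n) m.+1 U =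
    A n ^ m.+1 + (cov (@blocks n) m.+1 [set i1] + cov (@blocks n) m.+1 [set i2] +
    cov (@blocks n) m.+1 [set i1; i2]) + cov (@blocks n) m.+1 [set i3].
  have ne (U V : {set 'I_n.+1}) :
      (i1 \in U, i2 \in U, i3 \in U) != (i1 \in V, i2 \in V, i3 \in V) -> (U == V) = false.
    by move=> h; apply/negbTE; apply: contra_neq h => ->.
  rewrite /S -!setUA.
  do 4!(rewrite big_setU1 /=; last by rewrite !inE !ne //
    !inE ?eqxx ?n12 ?n13 ?n23 ?n21 ?n31 ?n32).
  by rewrite big_set1 cov_set0 -/(A n) !addnA.
rewrite SE.
have f1 : superset_count (@blocks n) [set i1] = A (n - 1).
  by rewrite superset_count1 i1E A_1 mul1n.
have f2 : superset_count (@blocks n) [set i2] = A (n - 1).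
  by rewrite superset_count1 i2E subKn ?A_1 ?muln1 //; lia.
have f12 : superset_count (@blocks n) [set i1; i2] = A (n - 2).
  rewrite superset_count2 ?i1E ?i2E; last by lia.
  by rewrite A_1 mul1n subKn ?A_1 ?muln1 -?subnDA //; lia.
have hB : (2 * m.+1 ^ 2 + 2 * m.+1) * A (n - 1) <= #|monotone_triangle n|.
  by have := hn1 n ltac:(lia); rewrite expn0 muln1 subn1.
have hs := cov_pair_lower (@blocks_correlation n) (negbT n12) f1 f2 f12 hB.
rewrite -/(A n) expnS mulnCA leq_pmul2l ?A_gt0 // in hs.
have h3 : A (n - 2) * A n ^ m <= cov (@blocks n) m.+1 [set i3].
  apply: leq_trans (cov_ge _ _ _); rewrite superset_count1 i3E -/(A n).
  by rewrite leq_mul2r leq_pmull ?A_gt0 ?orbT.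
have hE : 25 * m.+2 <= A (n - 2).
  have := hn2 (n - 2) ltac:(lia); rewrite expn0 muln1; apply: leq_trans.
  by rewrite leq_pmulr // A_gt0.
rewrite -/(A n).
have card25 : #|@bump_triangle n @: S| ^ 2 <= 25 by rewrite -[25]/(5 ^ 2) leq_exp2r.
move: card25 hs h3 hE; move: (#|_| ^ 2) (_ + _ + _) (cov _ _ [set i3]) => z s c z25 hs h3 hE h.
have h4 : m.+2 * m.+1 * z * A n ^ m <= m.+1 * A (n - 2) * A n ^ m.
  rewrite leq_mul2r; apply/orP; right.
  apply: leq_trans (_ : m.+1 * (25 * m.+2) <= _); last by rewrite leq_mul2l hE orbT.
  have -> : m.+2 * m.+1 * z = m.+1 * (z * m.+2) by lia.
  by rewrite leq_mul2l leq_mul2r z25 !orbT.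
have h5 := leq_mul (leqnn m.+2) (leq_add (leq_add (leqnn (A n ^ m.+1)) hs) h3).
have := leq_trans h5 (leq_trans h (leq_add (leqnn _) h4)).
move: (A n ^ m) (A n ^ m.+1) (A (n - 1)) (A (n - 2)) => P Q b e; clear.
lia.
Qed.

(** * From counts to probabilities *)

Local Open Scope ring_scope.

Lemma p_minE (R : realFieldType) r n : (0 < r)%N ->
  p_min R r n = (cov (@blocks n) r [set: 'I_n.+1])%:R / (A n)%:R ^+ r.
Proof.
move=> r0; rewrite /p_min /iid_prob.
rewrite (eq_bigl (fun w => covers (@blocks n) w [set: 'I_n.+1])); last first.
  by move=> w; rewrite inf_triangle_covers.
rewrite (eq_bigr (fun _ => (A n)%:R ^- r)); last first.
  by move=> w _; rewrite prodr_const card_ord exprVn.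
by rewrite sumr_const [RHS]mulr_natl /cov cardsE.
Qed.

Theorem theorem2 (R : realFieldType) (r : nat) (hr : (2 <= r)%N) :
  exists e : nat -> R,
    is_Theta e (fun n => (A (n - 2))%:R * (A n)%:R ^+ (r - 2)) /\
    forall n : nat, (2 <= n)%N ->
      p_min R r n =
        (r%:R * (A n)%:R ^+ (r - 1)
         + 2%:R * r%:R * (r%:R - 1) * (A (n - 1))%:R * (A n)%:R ^+ (r - 2)
         + e n) / (A n)%:R ^+ r.
Proof.
case: r hr => [|[|m]] // _; rewrite subn1 subn2 /=.
pose main n : R := m.+2%:R * (A n)%:R ^+ m.+1
  + 2%:R * m.+2%:R * (m.+2%:R - 1) * (A (n - 1))%:R * (A n)%:R ^+ m.
have mainE n : main n = (m.+2 * A n ^ m.+1 + 2 * m.+2 * m.+1 * A (n - 1) * A n ^ m)%:R.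
  rewrite /main natrD !natrM !natrX; congr (_ + _ * _ * _ * _ * _).
  by rewrite -[m.+2]addn1 natrD addrK.
(* The error is the exact remainder, so the formula is immediate and only its order is at stake. The
   upper constant is [C.+1] to be positive. *)
exists (fun n => (cov (@blocks n) m.+2 [set: 'I_n.+1])%:R - main n); split.
  have [C [n1 hC]] := cov_blocks_upper m; have [n2 hc] := cov_blocks_lower m.
  exists 1, C.+1%:R; split; rewrite ?ltr01 ?ltr0Sn //.
  exists (n1 + n2)%N => n nn; rewrite mul1r mainE -natrX -natrM -natrM.
  rewrite lerBrDl lerBlDl -!natrD !ler_nat hc; last by lia.
  by apply: leq_trans (hC n _) _; [lia | rewrite leq_add2l leq_mul2r leqnSn orbT].
by move=> n _; rewrite p_minE // -/(main n) addrC subrK.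
Qed.
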